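(* Let $\langle\mathcal{P},\mathcal{S}\rangle$ be an ADP problem. For a set $\mathcal{J}$ of dependency pairs and an ADP $\alpha=\ell\to\{p_1:r_1,\dots,p_k:r_k\}^m\in\mathcal{P}$ let $\alpha|_{\mathcal{J}}=\ell\to\{p_1:\sharp_{\Phi_1}(r_1),\dots,p_k:\sharp_{\Phi_k}(r_k)\}^m$, where for $1\le j\le k$, $\pi\in\Phi_j$ iff there is a dependency pair $\ell^\sharp\to t^\sharp\in\mathcal{J}$ with $t\trianglelefteq_\sharp^\pi r_j$. Let $\mathcal{P}|_{\mathcal{J}}=\{\alpha|_{\mathcal{J}}\mid\alpha\in\mathcal{P}\}$ and $\mathcal{S}|_{\mathcal{J}}=\{\alpha|_{\mathcal{J}}\mid\alpha\in\mathcal{S}\}$. Then the processor \[\mathrm{Proc}_{\mathtt{DG}}(\langle\mathcal{P},\mathcal{S}\rangle)=(\mathrm{Pol}_0,\{\langle\mathcal{P}|_{\mathcal{J}},\mathcal{S}|_{\mathcal{J}}\rangle\mid\mathcal{J}\text{ is an SCC-prefix of the }\mathcal{P}\text{-dependency graph}\})\] is sound.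
   Context: Annotated dependency pairs (ADPs): over a finite signature $\Sigma$ with fresh annotated copies $f^\sharp$ of the defined symbols, an ADP is $\ell\to\{p_1:r_1,\dots,p_k:r_k\}^m$ with $\ell$ a non-variable unannotated term, $r_j$ possibly annotated, $\mathcal{V}(r_j)\subseteq\mathcal{V}(\ell)$, $0<p_j\le1$, $\sum p_j=1$, flag $m\in\{\mathsf{true},\mathsf{false}\}$. For a set $\mathcal{P}$, defined symbols are roots of left-hand sides; basic terms are $f(t_1,\dots,t_k)$ with $f$ defined and $t_i$ free of defined symbols; $|t|$ term size; $\flat$ removes all annotations; $t^\sharp$ annotates the root; $\sharp_\Phi(t)$ is the term $t$ with exactly the (defined or annotated) symbols at positions in $\Phi$ annotated and all other annotations removed; $\flat^\uparrow_\pi$ removes annotations strictly above $\pi$; $t\trianglelefteq_\sharp^\pi s$ means $s$ has an annotated symbol at $\pi$ and $t=\flat(s|_\pi)$; $t\trianglelefteq_\sharp s$ means this holds for some $\pi$. Rewriting with $\mathcal{P}$ (innermost): at a position $\pi$ with defined or annotated symbol, ADP $\ell\to\{p_j:r_j\}^m\in\mathcal{P}$, $\sigma$ with $\flat(s|_\pi)=\ell\sigma$ whose proper subterms are normal forms: $t_j=s[r_j\sigma]_\pi$ (at: $m=\mathsf{true}$, $\pi$ annotated), $s[\flat(r_j)\sigma]_\pi$ (nt), $\flat^\uparrow_\pi(s[r_j\sigma]_\pi)$ (af), $\flat^\uparrow_\pi(s[\flat(r_j)\sigma]_\pi)$ (nf). A term is in argument normal form w.r.t. $\mathcal{P}$ if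 all its proper subterms are normal forms. $\mathcal{P}$-chain trees: possibly infinite finitely-branching trees with nodes $(p_v:t_v)$, root probability 1, $t_v$ rewriting to $\{\tfrac{p_w}{p_v}:t_w\}_w$ at inner nodes. For $\mathcal{S}\subseteq\mathcal{P}$, $\operatorname{edl}_{\langle\mathcal{P},\mathcal{S}\rangle}(\mathfrak{T})$ sums $p_v$ over inner nodes rewritten by (at)/(af)-steps with ADPs in $\mathcal{S}$; $\operatorname{edh}_{\langle\mathcal{P},\mathcal{S}\rangle}(t)$ = sup over chain trees rooted at $t^\sharp$; $\iota_{\langle\mathcal{P},\mathcal{S}\rangle}=\iota(n\mapsto\sup\{\operatorname{edh}_{\langle\mathcal{P},\mathcal{S}\rangle}(t)\mid t\text{ basic},|t|\le n\})$; complexities $\mathfrak{C}=\{\mathrm{Pol}_0,\mathrm{Pol}_1,\dots,\mathrm{Exp},\mathrm{2\text{-}Exp},\mathrm{Fin},\omega\}$ ordered in that order, $\oplus$ = maximum, $\iota(f)=\mathrm{Pol}_a$ for least $a$ with $f\in O(n^a)$, else $\mathrm{Exp}$ if $f\in O(2^{\mathrm{pol}(n)})$, else $\mathrm{2\text{-}Exp}$ if $f\in O(2^{2^{\mathrm{pol}(n)}})$, else $\mathrm{Fin}$ if $f$ never equals $\omega$, else $\omega$. Dependency graph: $\mathrm{np}(\mathcal{P})=\{\ell\to\flat(r_j)\mid\ell\to\{p_1:r_1,\dots,p_k:r_k\}^{\mathsf{true}}\in\mathcal{P},1\le j\le k\}$ (an ordinary TRS). For an ADP $\alpha=\ell\to\{p_1:r_1,\dots,p_k:r_k\}^m$,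 $\mathrm{dp}(\alpha)=\{\ell^\sharp\to t^\sharp\mid1\le j\le k,t\trianglelefteq_\sharp r_j\}$; $\mathrm{dp}^\bot(\alpha)=\{\ell^\sharp\to\bot\}$ ($\bot$ a fresh symbol) if $\mathrm{dp}(\alpha)=\emptyset$ and $\mathrm{dp}(\alpha)$ otherwise; $\mathrm{dp}(\mathcal{P})=\bigcup_{\alpha\in\mathcal{P}}\mathrm{dp}^\bot(\alpha)$. The $\mathcal{P}$-dependency graph has nodes $\mathrm{dp}(\mathcal{P})$ and an edge from $\ell_1^\sharp\to t_1^\sharp$ to $\ell_2^\sharp\to\dots$ iff there are substitutions $\sigma_1,\sigma_2$ with $t_1^\sharp\sigma_1$ reducing in zero or more innermost $\mathrm{np}(\mathcal{P})$-steps to $\ell_2^\sharp\sigma_2$ and $\ell_1^\sharp\sigma_1,\ell_2^\sharp\sigma_2$ in argument normal form w.r.t. $\mathcal{P}$. An SCC is a maximal set $\mathcal{G}$ of nodes such that for all $\alpha,\alpha'\in\mathcal{G}$ there is a non-empty path from $\alpha$ to $\alpha'$ traversing only nodes of $\mathcal{G}$. A node reaches $\mathcal{G}$ if there is a path of length $\ge0$ to it. $\mathcal{J}\subseteq\mathrm{dp}(\mathcal{P})$ is an SCC-prefix if there is an SCC $\mathcal{G}\subseteq\mathcal{J}$ such that $\mathcal{J}$ is a maximal set in which all elements reach $\mathcal{G}$ and for all $\alpha,\beta\in\mathcal{J}$, $\alpha$ reaches $\beta$ or $\beta$ reaches $\alpha$. ADP problems, proof trees, soundness: ADP problem $\langle\mathcal{P},\mathcal{S}\rangle$,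 $\mathcal{P}$ finite, $\mathcal{S}\subseteq\mathcal{P}$, solved iff $\mathcal{S}=\emptyset$. A processor maps an ADP problem to $(c,\{\langle\mathcal{P}_1,\mathcal{S}_1\rangle,\dots,\langle\mathcal{P}_n,\mathcal{S}_n\rangle\})$, $c\in\mathfrak{C}$. A proof tree is a finite tree with labels $L_{\mathcal{A}}$ (ADP problems), $L_{\mathcal{C}}$ (complexities) where each inner node and its children arise by a processor application and leaves carry $\mathrm{Pol}_0$ if solved, $\omega$ otherwise; it is well formed if for each node $v$ with $L_{\mathcal{A}}(v)=\langle\mathcal{P},\mathcal{S}\rangle$ and root path $v_1,\dots,v_k=v$: $\iota_{\langle\mathcal{P},\mathcal{S}\rangle}\sqsubseteq L_{\mathcal{C}}(v_1)\oplus\dots\oplus L_{\mathcal{C}}(v_{k-1})\oplus\max\{L'_{\mathcal{C}}(w)\mid w$ reachable from $v$, incl. $v\}$ and $\iota_{\langle\mathcal{P},\mathcal{P}\setminus\mathcal{S}\rangle}\sqsubseteq L_{\mathcal{C}}(v_1)\oplus\dots\oplus L_{\mathcal{C}}(v_{k-1})$ ($L'_{\mathcal{C}}=L_{\mathcal{C}}$ on inner nodes, $\iota_{L_{\mathcal{A}}(w)}$ on leaves). A processor with output $(c,\{\langle\mathcal{P}_i,\mathcal{S}_i\rangle\}_{i\le n})$ on $\langle\mathcal{P},\mathcal{S}\rangle$ is sound if for every well-formed proof tree and node $v$ labeled $\langle\mathcal{P},\mathcal{S}\rangle$ with root path $v_1,\dots,v_k=v$: $\iota_{\langle\mathcal{P},\mathcal{S}\rangle}\sqsubseteq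 L_{\mathcal{C}}(v_1)\oplus\dots\oplus L_{\mathcal{C}}(v_{k-1})\oplus c\oplus\iota_{\langle\mathcal{P}_1,\mathcal{S}_1\rangle}\oplus\dots\oplus\iota_{\langle\mathcal{P}_n,\mathcal{S}_n\rangle}$ and $\iota_{\langle\mathcal{P}_i,\mathcal{P}_i\setminus\mathcal{S}_i\rangle}\sqsubseteq L_{\mathcal{C}}(v_1)\oplus\dots\oplus L_{\mathcal{C}}(v_{k-1})\oplus c$ for all $i$. *)

(* Defs.v *)
From HB Require Import structures.
From mathcomp Require Import all_boot all_order all_algebra.
From mathcomp Require Import all_classical all_reals all_analysis.
From mathcomp Require Import Rstruct.
From Stdlib Require Import Relations.Relation_Operators.

Set Implicit Arguments.
Unset Strict Implicit.
Unset Printing Implicit Defensive.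

Import Order.TTheory GRing.Theory Num.Theory.
Local Open Scope classical_set_scope.
Local Open Scope ring_scope.

Notation R := Rdefinitions.R.

Record signature := Signature { sym : finType; arity : sym -> nat }.

(* Terms over Sigma^# : every function symbol carries an annotation bit
   (true = the annotated copy f^#).  Variables are natural numbers. *)
Inductive term (Sg : signature) : Type :=
| Var of nat
| Fun of sym Sg & bool & seq (term Sg).
Arguments Var {Sg}.
Arguments Fun {Sg}.

Section Terms.
Context {Sg : signature}.
Local Notation term := (term Sg).

Fixpoint onth {T} (s : seq T) (i : nat) : option T :=
  match s, i with
  | [::], _ => None
  | x :: _, 0 => Some x
  | _ :: s', i'.+1 => onth s' i'
  end.

Fixpoint wf_term (t : term) : bool :=
  match t with
  | Var _ => true
  | Fun f _ ts => (size ts == arity f) && all wf_term ts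
  end.

Fixpoint tsize (t : term) : nat :=
  match t with
  | Var _ => 1
  | Fun _ _ ts => (sumn (map tsize ts)).+1
  end.

Fixpoint vars (t : term) : seq nat :=
  match t with
  | Var x => [:: x]
  | Fun _ _ ts => flatten (map vars ts)
  end.

Fixpoint unann (t : term) : bool :=
  match t with
  | Var _ => true
  | Fun _ a ts => ~~ a && all unann ts
  end.

Fixpoint flat (t : term) : term :=
  match t with
  | Var x => Var x
  | Fun f _ ts => Fun f false (map flat ts)
  end.

Definition sharp_root (t : term) : term :=
  match t with
  | Var x => Var x
  | Fun f _ ts => Fun f true ts
  end.

Fixpoint subst (s : nat -> term) (t : term) : term :=
  match t with
  | Var x => s x
  | Fun f a ts => Fun f a (map (subst s) ts)
  end.

Fixpoint subterm_at (t : term) (p : seq nat) : option term :=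
  match p with
  | [::] => Some t
  | i :: p' =>
      match t with
      | Var _ => None
      | Fun _ _ ts => match onth ts i with
                      | Some u => subterm_at u p'
                      | None => None
                      end
      end
  end.

Fixpoint replace (t : term) (p : seq nat) (u : term) : term :=
  match p with
  | [::] => u
  | i :: p' =>
      match t with
      | Var x => Var x
      | Fun f a ts =>
          Fun f a [seq (if jt.1 == i then replace jt.2 p' u else jt.2)
                  | jt <- zip (iota 0 (size ts)) ts]
      end
  end.

Fixpoint flat_above (p : seq nat) (t : term) : term :=
  match p with
  | [::] => t
  | i :: p' =>
      match t with
      | Var x => Var x
      | Fun f _ ts =>
          Fun f false [seq (if jt.1 == i then flat_above p' jt.2 else jt.2)
                      | jt <- zip (iota 0 (size ts)) ts]
      end
  end.

Fixpoint sharp_Phi_at (D : sym Sg -> Prop) (Phi : seq nat -> Prop)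
    (q : seq nat) (t : term) : term :=
  match t with
  | Var x => Var x
  | Fun f a ts =>
      Fun f `[< Phi q /\ (D f \/ a) >]
        ((fix go (j : nat) (us : seq term) : seq term :=
            match us with
            | [::] => [::]
            | u :: us' => sharp_Phi_at D Phi (rcons q j) u :: go j.+1 us'
            end) 0 ts)
  end.
Definition sharp_Phi D Phi t := sharp_Phi_at D Phi [::] t.

Definition ann_sub (t : term) (pi : seq nat) (s : term) : Prop :=
  exists f ts, subterm_at s pi = Some (Fun f true ts) /\ t = flat (Fun f true ts).

End Terms.

Record adp (Sg : signature) := ADP {
  lhs : term Sg;
  rhs : seq (R * term Sg);   (* the multi-distribution {p_1:r_1,...,p_k:r_k} *)
  flag : bool }.
Arguments ADP {Sg}.

Section ADPs.
Context {Sg : signature}.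
Local Notation term := (term Sg).
Local Notation adp := (adp Sg).

Definition defined (P : set adp) (f : sym Sg) : Prop :=
  exists alpha a ts, P alpha /\ lhs alpha = Fun f a ts.

Definition valid_adp (D : sym Sg -> Prop) (alpha : adp) : Prop :=
  [/\ (exists f ts, lhs alpha = Fun f false ts),
      unann (lhs alpha), wf_term (lhs alpha),
      (forall p r, List.In (p, r) (rhs alpha) ->
          [/\ wf_term r, {subset vars r <= vars (lhs alpha)}, 0 < p, p <= 1 &
              (forall pi f ts, subterm_at r pi = Some (Fun f true ts) -> D f)])
    & \sum_(pr <- rhs alpha) pr.1 = 1].

Definition problem := (set adp * set adp)%type.
Definition adp_problem (A : problem) : Prop :=
  [/\ finite_set A.1, A.2 `<=` A.1 & forall alpha, A.1 alpha -> valid_adp (defined A.1) alpha].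

Definition NF (P : set adp) (u : term) : Prop :=
  ~ exists q w alpha (sg : nat -> term),
      P alpha /\ subterm_at u q = Some w /\ flat w = subst sg (lhs alpha).

Definition argNF (P : set adp) (s : term) : Prop :=
  forall q u, q != [::] -> subterm_at s q = Some u -> NF P u.

Inductive step_kind := k_at | k_nt | k_af | k_nf.

Definition step_ok (P : set adp) (s : term) (alpha : adp) (pi : seq nat)
    (sg : nat -> term) (k : step_kind) : Prop :=
  exists f a ts,
    [/\ subterm_at s pi = Some (Fun f a ts),
        defined P f \/ a = true,
        flat (Fun f a ts) = subst sg (lhs alpha),
        argNF P (subst sg (lhs alpha)) &
        match k with
        | k_at => flag alpha = true /\ a = true
        | k_nt => flag alpha = true /\ a = false
        | k_af => flag alpha = false /\ a = true
        | k_nf => flag alpha = false /\ a = false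
        end].

Definition step_result (s : term) (pi : seq nat) (sg : nat -> term)
    (k : step_kind) (r : term) : term :=
  match k with
  | k_at => replace s pi (subst sg r)
  | k_nt => replace s pi (subst sg (flat r))
  | k_af => flat_above pi (replace s pi (subst sg r))
  | k_nf => flat_above pi (replace s pi (subst sg (flat r)))
  end.

(* P-chain trees.  Nodes are addressed by sequences of child indices;
   the children of an inner node v are rcons v i, i < ct_kids v.
   Inner nodes record the rewrite step performed there. *)
Record ctree := CTree {
  ct_node : set (seq nat);
  ct_prob : seq nat -> R;
  ct_term : seq nat -> term;
  ct_kids : seq nat -> nat;          (* 0 for leaves *)
  ct_adp  : seq nat -> adp;
  ct_pos  : seq nat -> seq nat;
  ct_kind : seq nat -> step_kind }.

Definition is_chain_tree (P : set adp) (t0 : term) (T : ctree) : Prop :=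
  [/\ ct_node T [::], ct_prob T [::] = 1, ct_term T [::] = t0,
      (forall v i, ct_node T (rcons v i) <-> ct_node T v /\ (i < ct_kids T v)%N) &
      (forall v, ct_node T v -> (0 < ct_kids T v)%N ->
         exists sg : nat -> term,
         [/\ P (ct_adp T v),
             step_ok P (ct_term T v) (ct_adp T v) (ct_pos T v) sg (ct_kind T v),
             ct_kids T v = size (rhs (ct_adp T v)) &
             forall i, (i < ct_kids T v)%N ->
               let pr := nth (0, Var 0) (rhs (ct_adp T v)) i in
               ct_term T (rcons v i) =
                 step_result (ct_term T v) (ct_pos T v) sg (ct_kind T v) pr.2 /\
               ct_prob T (rcons v i) = ct_prob T v * pr.1])].

Definition edl (S : set adp) (T : ctree) : \bar R :=
  \esum_(v in [set v | [/\ ct_node T v, (0 < ct_kids T v)%N, S (ct_adp T v) &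
                          (ct_kind T v = k_at \/ ct_kind T v = k_af)]])
     (ct_prob T v)%:E.

Definition edh (P S : set adp) (t : term) : \bar R :=
  ereal_sup [set edl S T | T in [set T | is_chain_tree P (sharp_root t) T]].

Definition basic (P : set adp) (t : term) : Prop :=
  exists f ts, [/\ t = Fun f false ts, defined P f, wf_term t &
    forall u, List.In u ts -> unann u /\
      forall q g a us, subterm_at u q = Some (Fun g a us) -> ~ defined P g].

Definition dh_fun (P S : set adp) (n : nat) : \bar R :=
  ereal_sup [set edh P S t | t in [set t | basic P t /\ (tsize t <= n)%N]].

End ADPs.

Inductive cmplx := Pol of nat | CExp | CExp2 | CFin | COmega.

Definition cmplx_enc (c : cmplx) : option (option (option (option nat))) :=
  match c with
  | Pol a => Some (Some (Some (Some a)))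
  | CExp => Some (Some (Some None))
  | CExp2 => Some (Some None)
  | CFin => Some None
  | COmega => None
  end.
Definition cmplx_dec (x : option (option (option (option nat)))) : cmplx :=
  match x with
  | Some (Some (Some (Some a))) => Pol a
  | Some (Some (Some None)) => CExp
  | Some (Some None) => CExp2
  | Some None => CFin
  | None => COmega
  end.
Lemma cmplx_encK : cancel cmplx_enc cmplx_dec. Proof. by case. Qed.
HB.instance Definition _ := Countable.copy cmplx (can_type cmplx_encK).

Definition cle (x y : cmplx) : bool :=
  match x, y with
  | Pol a, Pol b => (a <= b)%N
  | Pol _, _ => true
  | CExp, Pol _ => false
  | CExp, _ => true
  | CExp2, (Pol _ | CExp) => false
  | CExp2, _ => true
  | CFin, (CFin | COmega) => true
  | CFin, _ => false
  | COmega, COmega => true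
  | COmega, _ => false
  end.

Definition cmax (x y : cmplx) : cmplx := if cle x y then y else x.

(* maximum of a (finite) set of complexities; Pol_0 (the neutral element)
   for the empty set *)
Definition cmax_set (X : set cmplx) : cmplx :=
  xget (Pol 0) [set m | X m /\ forall y, X y -> cle y m].

Definition bigO (f : nat -> \bar R) (g : nat -> R) : Prop :=
  exists (c : R) (n0 : nat), forall n, (n0 <= n)%N -> (f n <= (c * g n)%:E)%E.

Definition peval (cs : seq nat) (n : nat) : nat :=
  \sum_(i < size cs) nth 0%N cs i * n ^ i.

Definition classify (f : nat -> \bar R) (c : cmplx) : Prop :=
  let isPol a := bigO f (fun n => (n%:R : R) ^+ a) in
  let isExp := exists cs, bigO f (fun n => (2 : R) ^+ peval cs n) in
  let isExp2 := exists cs, bigO f (fun n => (2 : R) ^+ (2 ^ peval cs n)) in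
  match c with
  | Pol a => isPol a /\ forall b, (b < a)%N -> ~ isPol b
  | CExp => (forall a, ~ isPol a) /\ isExp
  | CExp2 => (forall a, ~ isPol a) /\ ~ isExp /\ isExp2
  | CFin => (forall a, ~ isPol a) /\ ~ isExp /\ ~ isExp2 /\ forall n, f n != +oo%E
  | COmega => (forall a, ~ isPol a) /\ ~ isExp /\ ~ isExp2 /\ exists n, f n = +oo%E
  end.

Definition iota_c (f : nat -> \bar R) : cmplx := xget COmega [set c | classify f c].

Definition iota_pb {Sg : signature} (A : problem (Sg:=Sg)) : cmplx :=
  iota_c (dh_fun A.1 A.2).

Section DG.
Context {Sg : signature}.
Local Notation term := (term Sg).
Local Notation adp := (adp Sg).

(* a dependency pair l^# -> t^#, or l^# -> ⊥ (second component None) *)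
Definition dpair := (term * option term)%type.

Definition dp (alpha : adp) : set dpair :=
  [set x | exists p r t pi, [/\ List.In (p, r) (rhs alpha), ann_sub t pi r &
             x = (sharp_root (lhs alpha), Some (sharp_root t))]].

Definition dp_bot (alpha : adp) : set dpair :=
  [set x | dp alpha x \/ (dp alpha = set0 /\ x = (sharp_root (lhs alpha), None))].

Definition dpP (P : set adp) : set dpair := [set x | exists alpha, P alpha /\ dp_bot alpha x].

Definition np (P : set adp) : set (term * term) :=
  [set lr | exists alpha p r, [/\ P alpha, flag alpha = true, List.In (p, r) (rhs alpha) &
                                lr = (lhs alpha, flat r)]].

Definition NF_trs (Rs : set (term * term)) (u : term) : Prop :=
  ~ exists q w l r (sg : nat -> term), Rs (l, r) /\ subterm_at u q = Some w /\ w = subst sg l.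

Definition itrs_step (Rs : set (term * term)) (s t : term) : Prop :=
  exists pi l r (sg : nat -> term),
    [/\ Rs (l, r), subterm_at s pi = Some (subst sg l),
        (forall q u, q != [::] -> subterm_at (subst sg l) q = Some u -> NF_trs Rs u) &
        t = replace s pi (subst sg r)].

Definition plain_subst (sg : nat -> term) : Prop := forall x, unann (sg x) /\ wf_term (sg x).

Definition dg_edge (P : set adp) (x y : dpair) : Prop :=
  dpP P x /\ dpP P y /\
  exists t1 (sg1 sg2 : nat -> term),
    [/\ x.2 = Some t1, plain_subst sg1 /\ plain_subst sg2,
        clos_refl_trans _ (itrs_step (np P)) (subst sg1 t1) (subst sg2 y.1),
        argNF P (subst sg1 x.1) & argNF P (subst sg2 y.1)].

Definition reach (P : set adp) (x y : dpair) : Prop := clos_refl_trans _ (dg_edge P) x y.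

Definition reaches_set (P : set adp) (x : dpair) (G : set dpair) : Prop :=
  exists y, G y /\ reach P x y.

Definition strongly_conn (P : set adp) (G : set dpair) : Prop :=
  forall a b, G a -> G b -> clos_trans _ (fun x y => [/\ G x, G y & dg_edge P x y]) a b.

Definition SCC (P : set adp) (G : set dpair) : Prop :=
  [/\ G `<=` dpP P, strongly_conn P G &
      forall G', G `<=` G' -> G' `<=` dpP P -> strongly_conn P G' -> G' = G].

Definition prefix_ok (P : set adp) (G K : set dpair) : Prop :=
  [/\ K `<=` dpP P, (forall a, K a -> reaches_set P a G) &
      (forall a b, K a -> K b -> reach P a b \/ reach P b a)].

Definition SCC_prefix (P : set adp) (J : set dpair) : Prop :=
  exists G, [/\ SCC P G, G `<=` J, prefix_ok P G J &
                forall K, J `<=` K -> prefix_ok P G K -> K = J].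

Definition restrict (D : sym Sg -> Prop) (J : set dpair) (alpha : adp) : adp :=
  ADP (lhs alpha)
      [seq (pr.1, sharp_Phi D
                    (fun pi => exists t, J (sharp_root (lhs alpha), Some (sharp_root t))
                                         /\ ann_sub t pi pr.2) pr.2)
      | pr <- rhs alpha]
      (flag alpha).

Definition restrict_set (P : set adp) (J : set dpair) (X : set adp) : set adp :=
  [set restrict (defined P) J alpha | alpha in X].

End DG.

Inductive ptree (Sg : signature) :=
  PNode of problem (Sg:=Sg) & cmplx & seq (ptree Sg).
Arguments PNode {Sg}.

Section Proofs.
Context {Sg : signature}.
Local Notation ptree := (ptree Sg).

Definition pt_label (T : ptree) : problem := let: PNode A _ _ := T in A.

Fixpoint subtree_at (T : ptree) (a : seq nat) : option ptree :=
  match a with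
  | [::] => Some T
  | i :: a' => let: PNode _ _ ch := T in
               match onth ch i with Some u => subtree_at u a' | None => None end
  end.

Fixpoint pt_ok (T : ptree) : Prop :=
  let: PNode A c ch := T in
  [/\ adp_problem A,
      (ch = [::] -> (A.2 = set0 /\ c = Pol 0) \/ (A.2 <> set0 /\ c = COmega)) &
      (fix go (us : seq ptree) : Prop :=
         match us with [::] => True | u :: us' => pt_ok u /\ go us' end) ch].

Fixpoint path_max (T : ptree) (a : seq nat) : cmplx :=
  match a with
  | [::] => Pol 0
  | i :: a' => let: PNode _ c ch := T in
               cmax c (match onth ch i with Some u => path_max u a' | None => Pol 0 end)
  end.

Fixpoint reach_max (T : ptree) : cmplx :=
  let: PNode A c ch := T in
  match ch with
  | [::] => iota_pb A
  | _ => cmax c (foldr cmax (Pol 0) (map reach_max ch))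
  end.

Definition well_formed (T : ptree) : Prop :=
  pt_ok T /\
  forall a u, subtree_at T a = Some u ->
    cle (iota_pb (pt_label u)) (cmax (path_max T a) (reach_max u)) /\
    cle (iota_pb ((pt_label u).1, (pt_label u).1 `\` (pt_label u).2)) (path_max T a).

Definition processor := problem (Sg:=Sg) -> cmplx * set (problem (Sg:=Sg)).

Definition sound (proc : processor) : Prop :=
  forall A, adp_problem A ->
  forall T a u, well_formed T -> subtree_at T a = Some u -> pt_label u = A ->
    cle (iota_pb A)
        (cmax (cmax (path_max T a) (proc A).1)
              (cmax_set [set iota_pb B | B in (proc A).2])) /\
    forall B, (proc A).2 B ->
      cle (iota_pb (B.1, B.1 `\` B.2)) (cmax (path_max T a) (proc A).1).

Definition Proc_DG : processor := fun A =>
  (Pol 0, [set (restrict_set A.1 J A.1, restrict_set A.1 J A.2) | J in SCC_prefix A.1]).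

End Proofs.

(* Main.v *)
Require Import Defs.
From mathcomp Require Import all_boot all_order all_algebra.
From mathcomp Require Import all_classical all_reals all_analysis.
From mathcomp Require Import Rstruct.
From Stdlib Require Import Relations.Relation_Operators.
(* Re-imported so that [onth] is the function of the definitions and not [seq.onth]. *)
Import Defs.

(** Annotated positions of a chain tree carry a history: the dependency pairs that created the
    annotation, a path of the dependency graph. If the newest pair of the history reaches a
    cycle, then the whole history lies in some SCC-prefix [J], and the step survives when the
    tree is replayed with the ADPs restricted to [J]. Otherwise the newest pair only has
    boundedly many successors, so such steps are controlled by a potential: give an annotation
    the weight [(B+1)^rank], where [B] bounds the number of annotations of a right-hand side and
    [rank] strictly decreases along edges outside the reach of cycles. Hence the expected
    number of annotated steps of [P] is at most [C + C * m], where [m] is the sum of the numbers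
    for the restrictions [P|J]. The steps of [P|J] not in [S|J] lift to steps of [P \ S], whose
    complexity is already accounted for on the path to the node by well-formedness of the proof
    tree. *)

Set Implicit Arguments.
Unset Strict Implicit.
Unset Printing Implicit Defensive.

Import Order.TTheory GRing.Theory Num.Theory.
Local Open Scope classical_set_scope.
Local Open Scope ring_scope.

(** * Terms and annotations *)

Section Onth.
Context {A B : Type}.
Implicit Types (s : seq A) (i : nat).

(** Redexes, normal forms and matching only see [flat] terms. A term is therefore split into its
    flattening, which a restriction to [J] does not affect, and its set of annotated positions. This
    is why a tree can be replayed with other annotations while keeping its nodes, positions and
    probabilities, and why expected numbers of steps can be compared node by node. The bound is
    proved for all of [P], even though the claim concerns [S]: an annotation used by an [S]-step may
    have been created by an ADP outside [S], so the potential argument cannot be run on [S] alone.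
    Since [S] is only recovered inside each [P|J], the bound on [P \ S] is needed a second time
    there. The constant [C] depends on [P] but not on the start term, and each complexity class is
    closed under sums and constant factors. Hence a step that survives in several prefixes may be
    counted several times, and the sum over all prefixes is as good as a maximum. *)

Lemma onth_mapE (g : A -> B) s i : onth (map g s) i = omap g (onth s i).
Proof. by elim: s i => [|x s IH] [|i] //=. Qed.

Lemma onth_ext (s s' : seq A) : (forall i, onth s i = onth s' i) -> s = s'.
Proof.
elim: s s' => [|x s IH] [|y s'] // H; try by have := H 0.
have := H 0 => -[->]; congr cons; apply: IH => i; exact: (H i.+1).
Qed.

Lemma onth_in_all (a : pred A) s i x : all a s -> onth s i = Some x -> a x.
Proof. by elim: s i => [|y s IH] [|i] //= /andP[ay /IH sa]; [case=> <-|exact: sa]. Qed.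

Lemma all_onth (a : pred A) s : (forall i x, onth s i = Some x -> a x) -> all a s.
Proof.
elim: s => [|y s IH] //= H; rewrite (H 0) //=; apply: IH => i x; exact: (H i.+1).
Qed.

Lemma In_onth s x : List.In x s <-> exists i, onth s i = Some x.
Proof.
elim: s => [|y s IH] /=; first by split=> // -[[]].
split=> [[->|/IH[i Hi]]|[[|i]]]; [by exists 0|by exists i.+1|by case; left|].
by move=> Hi; right; apply/IH; exists i.
Qed.

(** This map over a list zipped with its indices is how [replace] and [flat_above] change a single
    argument. *)
Lemma onth_upd i (g : A -> A) s j :
  onth [seq (if jt.1 == i then g jt.2 else jt.2) | jt <- zip (iota 0 (size s)) s] j =
  omap (fun u => if j == i then g u else u) (onth s j).
Proof.
suff H m : onth [seq (if jt.1 == i then g jt.2 else jt.2) | jt <- zip (iota m (size s)) s] j =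
  omap (fun u => if (m + j)%N == i then g u else u) (onth s j) by rewrite H.
elim: s m j => [|x s IH] m [|j] //=; first by rewrite addn0.
by rewrite IH addnS.
Qed.

End Onth.

Section Terms.
Context {Sg : signature}.
Local Notation term := (term Sg).
Implicit Types (t u w : term) (p q : seq nat) (sg : nat -> term).

(** The generated principle gives no hypothesis for the nested argument list. Arguments are
    addressed by [onth], as positions do. *)
Lemma term_onth_ind (Q : term -> Prop) :
  (forall x, Q (Var x)) ->
  (forall f a ts, (forall i u, onth ts i = Some u -> Q u) -> Q (Fun f a ts)) ->
  forall t, Q t.
Proof.
move=> HV HF; fix IH 1; case=> [x|f a ts]; first exact: HV.
apply: HF; elim: ts => [|u ts IHts] [|i] v /= E; try discriminate E.
- by case: E => <-; apply: IH.
- exact: IHts E.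
Qed.

(** Together with [flat t], the annotated positions determine [t]; a rewrite step acts on these two
    data separately. *)
Definition ann t p : bool :=
  if subterm_at t p is Some (Fun _ true _) then true else false.

Lemma ann_sub_ann t p u : ann_sub u p t -> ann t p.
Proof. by case=> f [ts [+ _]]; rewrite /ann => ->. Qed.

Lemma annP t p : ann t p -> exists f ts, subterm_at t p = Some (Fun f true ts).
Proof. by rewrite /ann; case: subterm_at => [[//|f [] ts]|] // _; exists f, ts. Qed.

Lemma subterm_at_cat t p q :
  subterm_at t (p ++ q) = obind (fun u => subterm_at u q) (subterm_at t p).
Proof.
elim: p t => [|i p IH] //= [x|f a ts] //.
by case: onth => //= u; rewrite IH.
Qed.

Lemma subterm_at_flat t p : subterm_at (flat t) p = omap flat (subterm_at t p).
Proof.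
elim: p t => [|i p IH] //= [x|f a ts] //=.
by rewrite onth_mapE; case: onth => //= u; rewrite IH.
Qed.

Lemma flat_flat t : flat (flat t) = flat t.
Proof.
elim/term_onth_ind: t => //= f a ts IH; congr Fun; apply: onth_ext => i.
by rewrite !onth_mapE; case E: onth => [u|] //=; rewrite (IH i).
Qed.

Lemma unann_flat t : unann (flat t).
Proof.
elim/term_onth_ind: t => //= f a ts IH; apply: all_onth => i u.
by rewrite onth_mapE; case E: onth => [w|] //= -[<-]; apply: (IH i).
Qed.

Lemma flat_unann t : unann t -> flat t = t.
Proof.
elim/term_onth_ind: t => //= f a ts IH /andP[/negbTE -> Hts]; congr Fun.
apply: onth_ext => i; rewrite onth_mapE; case E: onth => [u|] //=.
by rewrite (IH i) // (onth_in_all Hts E).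
Qed.

Lemma unann_subterm t p u : unann t -> subterm_at t p = Some u -> unann u.
Proof.
elim: p t => [|i p IH] //= [x|f a ts] //=; first by move=> ? [<-].
- by move=> Ht [<-].
- by move=> /andP[_ Hts]; case E: onth => [v|] //; apply: IH; exact: onth_in_all Hts E.
Qed.

Lemma wf_subterm t p u : wf_term t -> subterm_at t p = Some u -> wf_term u.
Proof.
elim: p t => [|i p IH] //= [x|f a ts] //=; first by move=> ? [<-].
- by move=> Ht [<-].
- by move=> /andP[_ Hts]; case E: onth => [v|] //; apply: IH; exact: onth_in_all Hts E.
Qed.

Lemma unannE t p : unann t -> ann t p = false.
Proof.
move=> Ht; apply/negP => /annP[f [ts E]].
by have := unann_subterm Ht E.
Qed.

Lemma ann_flat t p : ann (flat t) p = false.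
Proof. exact/unannE/unann_flat. Qed.

Lemma wf_flat t : wf_term (flat t) = wf_term t.
Proof.
elim/term_onth_ind: t => //= f a ts IH; rewrite size_map; congr andb.
rewrite all_map; elim: ts IH => //= u ts IHts IH.
by rewrite (IH 0 u) // IHts // => i; exact: (IH i.+1).
Qed.

Lemma vars_flat t : vars (flat t) = vars t.
Proof.
elim/term_onth_ind: t => //= f a ts IH; congr flatten.
rewrite -map_comp; apply: onth_ext => i; rewrite !onth_mapE.
by case E: onth => [u|] //=; rewrite (IH i).
Qed.

Lemma ann_cons f a ts i p :
  ann (Fun f a ts) (i :: p) = if onth ts i is Some u then ann u p else false.
Proof. by rewrite /ann /=; case: onth. Qed.

Lemma onth_replace i p u (ts : seq term) j :
  onth [seq (if jt.1 == i then replace jt.2 p u else jt.2)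
       | jt <- zip (iota 0 (size ts)) ts] j =
  omap (fun v => if j == i then replace v p u else v) (onth ts j).
Proof. exact: (onth_upd i (fun v => replace v p u)). Qed.

Lemma onth_flat_above i p (ts : seq term) j :
  onth [seq (if jt.1 == i then flat_above p jt.2 else jt.2)
       | jt <- zip (iota 0 (size ts)) ts] j =
  omap (fun v => if j == i then flat_above p v else v) (onth ts j).
Proof. exact: onth_upd. Qed.

Lemma flat_replace t p u : flat (replace t p u) = replace (flat t) p (flat u).
Proof.
elim: p t => [|i p IH] //= [x|f a ts] //=; congr Fun; apply: onth_ext => j.
by rewrite onth_mapE !onth_replace onth_mapE; case: onth => //= w; case: eqP => //; rewrite IH.
Qed.

Lemma flat_flat_above p t : flat (flat_above p t) = flat t.
Proof.
elim: p t => [|i p IH] //= [x|f a ts] //=; congr Fun; apply: onth_ext => j.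
by rewrite onth_mapE !onth_flat_above onth_mapE; case: onth => //= w; case: eqP => //; rewrite IH.
Qed.

Lemma ann_replace t p u w q : subterm_at t p = Some w ->
  ann (replace t p u) q = if prefix p q then ann u (drop (size p) q) else ann t q.
Proof.
elim: p t q => [|i p IH] t q; first by rewrite prefix0s drop0.
case: t => [x|f a ts] //=; case E: onth => [v|] // Hv.
case: q => [|j q] //=; rewrite !ann_cons onth_replace.
by case: (eqVneq j i) => [->|_] /=; [rewrite E /= IH|case: onth].
Qed.

Lemma ann_flat_above p t q :
  ann (flat_above p t) q = ann t q && ~~ (prefix q p && (q != p)).
Proof.
elim: p t q => [|i p IH] t q /=.
  by case: q => [|j q] /=; rewrite andbT.
case: t => [x|f a ts] /=; first by case: q.
case: q => [|j q] /=; first by rewrite andbF.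
rewrite !ann_cons onth_flat_above; case: onth => //= u.
rewrite eqseq_cons; case: (eqVneq j i) => [_|_] /=; [exact: IH | by rewrite andbT].
Qed.

(** The hypothesis is limited to the variables of [t] because a matching substitution is arbitrary
    outside the left-hand side. *)
Lemma ann_subst sg t q :
  (forall x, x \in vars t -> unann (sg x)) -> ann (subst sg t) q = ann t q.
Proof.
elim/term_onth_ind: t q => [x|f a ts IH] q /= H.
  by rewrite unannE ?H ?mem_head // /ann; case: q.
case: q => [|i q] //=; rewrite !ann_cons onth_mapE; case E: onth => [u|] //=.
apply: (IH i) => // x xu; apply: H; apply/flattenP; exists (vars u) => //.
elim: ts i E {IH} => [|v ts IHts] [|i] //=; first by case=> ->; rewrite mem_head.
by move/IHts; rewrite inE => ->; rewrite orbT.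
Qed.

Lemma subterm_at_subst sg t p u : subterm_at t p = Some u ->
  subterm_at (subst sg t) p = Some (subst sg u).
Proof.
elim: p t => [|i p IH] //= [x|f a ts] //=; first by move=> [<-].
- by case=> <-.
- by rewrite onth_mapE; case: onth => //= v; exact: IH.
Qed.

Lemma mem_vars x t : x \in vars t -> exists p, subterm_at t p = Some (Var x).
Proof.
elim/term_onth_ind: t => [y|f a ts IH] /=.
  by rewrite inE => /eqP ->; exists [::].
move=> Hx; suff [i [u [E xu]]] : exists i u, onth ts i = Some u /\ x \in vars u.
  by have [p Hp] := IH _ _ E xu; exists (i :: p); rewrite /= E.
elim: ts {IH} Hx => //= u ts IHts; rewrite mem_cat => /orP[xu|/IHts[i [v]]].
- by exists 0, u.
- by exists i.+1, v.
Qed.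

Lemma vars_subterm t p u : subterm_at t p = Some u -> {subset vars u <= vars t}.
Proof.
elim: p t => [|i p IH] //= [x|f a ts] //=; first by move=> [<-].
- by case=> <-.
- case E: onth => [v|] // /IH Hu x /Hu xv; apply/flattenP; exists (vars v) => //.
  elim: ts i E {Hu IH} => [|w ts IHts] [|i] //=; first by case=> ->; rewrite mem_head.
  by move/IHts; rewrite inE => ->; rewrite orbT.
Qed.

Lemma eq_subst sg sg' t :
  (forall x, x \in vars t -> sg x = sg' x) -> subst sg t = subst sg' t.
Proof.
elim/term_onth_ind: t => [x|f a ts IH] /= H; first by rewrite H ?mem_head.
congr Fun; apply: onth_ext => i; rewrite !onth_mapE; case E: onth => [u|] //=.
congr Some; apply: (IH i) => // x xu; apply: H.
by apply: (@vars_subterm (Fun f a ts) [:: i] u); rewrite //= E.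
Qed.

Lemma flat_subst sg t :
  (forall x, x \in vars t -> unann (sg x)) -> flat (subst sg t) = subst sg (flat t).
Proof.
elim/term_onth_ind: t => [x|f a ts IH] /= H; first by rewrite flat_unann ?H ?mem_head.
congr Fun; apply: onth_ext => i; rewrite !onth_mapE; case E: onth => [u|] //=.
congr Some; apply: (IH i) => // x xu; apply: H.
by apply: (@vars_subterm (Fun f a ts) [:: i] u); rewrite //= E.
Qed.

Lemma wf_subst sg t :
  wf_term t -> (forall x, x \in vars t -> wf_term (sg x)) -> wf_term (subst sg t).
Proof.
elim/term_onth_ind: t => [x|f a ts IH] /=; first by move=> _ H; rewrite H ?mem_head.
rewrite size_map => /andP[-> Hts] H /=; apply: all_onth => i w.
rewrite onth_mapE; case E: onth => [u|] //= -[<-].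
apply: (IH i) => //; first exact: onth_in_all Hts E.
move=> x xu; apply: H; by apply: (@vars_subterm (Fun f a ts) [:: i] u); rewrite //= E.
Qed.

Lemma wf_replace t p u : wf_term t -> wf_term u -> wf_term (replace t p u).
Proof.
move=> + Hu; elim: p t => [|i p IH] //= [x|f a ts] //= /andP[Hs Hts].
rewrite size_map size_zip size_iota minnn Hs /=; apply: all_onth => j w.
rewrite onth_replace; case E: onth => [v|] //= -[<-].
by have := onth_in_all Hts E; case: ifP => // _; apply: IH.
Qed.

Lemma subterm_at_replace_below t p q u w : subterm_at t p = Some w ->
  subterm_at (replace t p u) (p ++ q) = subterm_at u q.
Proof.
elim: p t => [|i p IH] //= [x|f a ts] //=.
by rewrite onth_replace; case: onth => //= v Hv; rewrite eqxx IH.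
Qed.

Lemma subterm_at_replace_above t p q u w : subterm_at t p = Some w ->
  subterm_at (replace t (p ++ q) u) p = Some (replace w q u).
Proof.
elim: p t => [|i p IH] //= t; first by case: t => [x|f a ts] [<-].
case: t => [x|f a ts] //=.
by rewrite onth_replace; case: onth => //= v Hv; rewrite eqxx IH.
Qed.

Lemma subterm_at_replace_parallel t p q u : ~~ prefix p q -> ~~ prefix q p ->
  subterm_at (replace t p u) q = subterm_at t q.
Proof.
elim: p t q => [|i p IH] t q; first by rewrite prefix0s.
case: t => [x|f a ts] //; case: q => [|j q] //=.
rewrite onth_replace (eq_sym j); case: onth => //= v.
by case: eqP => //= _; exact: IH.
Qed.

Lemma subterm_at_sharp_root t i p :
  subterm_at (sharp_root t) (i :: p) = subterm_at t (i :: p).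
Proof. by case: t. Qed.

Lemma sharp_root_replace t i p u :
  replace (sharp_root t) (i :: p) u = sharp_root (replace t (i :: p) u).
Proof. by case: t. Qed.

Section SharpPhi.
Variables (D : sym Sg -> Prop) (Phi : seq nat -> Prop).

(** Names the anonymous inner recursion of [sharp_Phi_at], so that it can be indexed by [onth]. *)
Definition sharp_Phi_args q :=
  fix go (j : nat) (us : seq term) : seq term :=
    match us with
    | [::] => [::]
    | u :: us' => sharp_Phi_at D Phi (rcons q j) u :: go j.+1 us'
    end.

Lemma sharp_Phi_atE q f a ts :
  sharp_Phi_at D Phi q (Fun f a ts) =
  Fun f `[< Phi q /\ (D f \/ a) >] (sharp_Phi_args q 0 ts).
Proof. by []. Qed.

Lemma onth_sharp_Phi_args q ts i :
  onth (sharp_Phi_args q 0 ts) i = omap (sharp_Phi_at D Phi (rcons q i)) (onth ts i).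
Proof.
suff H j : onth (sharp_Phi_args q j ts) i =
    omap (sharp_Phi_at D Phi (rcons q (j + i)%N)) (onth ts i) by rewrite H.
elim: ts i j => [|u ts IH] [|i] j //=; first by rewrite addn0.
by rewrite IH addnS.
Qed.

Lemma flat_sharp_Phi t : flat (sharp_Phi D Phi t) = flat t.
Proof.
(* The recursion accumulates the current position in [q], so the induction has to run over all
   [q]. *)
rewrite /sharp_Phi; move: [::] => q; elim/term_onth_ind: t q => // f a ts IH q.
rewrite sharp_Phi_atE [LHS]/= [RHS]/=; congr Fun.
apply: onth_ext => i; rewrite !onth_mapE onth_sharp_Phi_args; case E: onth => [u|] //=.
by rewrite (IH i).
Qed.

Lemma ann_sharp_Phi t p : ann (sharp_Phi D Phi t) p =
  if subterm_at t p is Some (Fun f a _) then `[< Phi p /\ (D f \/ a) >] else false.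
Proof.
rewrite /sharp_Phi -[in RHS](cat0s p); rewrite [X in subterm_at t X]/=.
move: [::] => q; elim: p t q => [|i p IH] t q.
  by rewrite cats0; case: t => [x|f a ts] //=; rewrite /ann /=; case: asbool.
case: t => [x|f a ts] //; rewrite sharp_Phi_atE ann_cons onth_sharp_Phi_args /=.
 case E: onth => [u|] //=.
by rewrite IH cat_rcons.
Qed.

End SharpPhi.

Fixpoint positions t : seq (seq nat) :=
  match t with
  | Var _ => [:: [::]]
  | Fun _ _ ts => [::] :: flatten
      [seq [seq jp.1 :: p | p <- jp.2] | jp <- zip (iota 0 (size ts)) (map positions ts)]
  end.

Lemma mem_positions t p : isSome (subterm_at t p) -> p \in positions t.
Proof.
elim/term_onth_ind: t p => [x|f a ts IH] [|i p] //=.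
rewrite inE /=; case E: onth => [u|] // /(IH _ _ E); rewrite -{1}[i]add0n.
elim: ts i {IH} 0%N E => [|v ts IHts] [|i] j //= => [[->]|E] Hp; rewrite mem_cat.
- by rewrite addn0 map_f.
- by rewrite addnS -addSn IHts ?orbT.
Qed.

(** The list form of [ann], for summing. [undup] provides uniqueness without an argument about
    [positions]. *)
Definition annpos t : seq (seq nat) := [seq p <- undup (positions t) | ann t p].

Lemma mem_annpos t p : (p \in annpos t) = ann t p.
Proof.
rewrite mem_filter; case H: (ann t p) => //=; rewrite mem_undup mem_positions //.
by have [f [ts ->]] := annP H.
Qed.

Lemma annpos_uniq t : uniq (annpos t).
Proof. by rewrite filter_uniq ?undup_uniq. Qed.

End Terms.

(** * Chain trees *)

Section ChainTrees.
Context {Sg : signature}.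
Local Notation term := (term Sg).
Local Notation adp := (adp Sg).
Implicit Types (P S : set adp) (t s u r : term) (p q v : seq nat) (sg : nat -> term).

Lemma basic_ann P t p : basic P t -> ann (sharp_root t) p -> p = [::].
Proof.
case=> f [ts [-> _ _ Hts]]; case: p => [//|i p].
rewrite ann_cons; case E: onth => [u|//].
have Hu : List.In u ts by apply/In_onth; exists i.
by have [/unannE -> _] := Hts _ Hu.
Qed.

(** A variable of [l] occurs at some position, so its value is a subterm of the unannotated term
    [flat u]. *)
Lemma matched_var sg l u x : flat u = subst sg l -> x \in vars l ->
  unann (sg x) /\ (wf_term u -> wf_term (sg x)).
Proof.
move=> E /mem_vars[p /(subterm_at_subst sg)]; rewrite -E /= => Hp; split.
- exact: unann_subterm (unann_flat u) Hp.
- by rewrite -wf_flat => Hu; exact: wf_subterm Hu Hp.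
Qed.

(** A step kind encodes two independent bits: whether the redex is annotated, and the flag of the
    ADP. *)
Definition sharp_kind (k : step_kind) : bool :=
  match k with k_at | k_af => true | _ => false end.

Definition flag_kind (k : step_kind) : bool :=
  match k with k_at | k_nt => true | _ => false end.

Definition mk_kind (fl an : bool) : step_kind :=
  if fl then (if an then k_at else k_nt) else (if an then k_af else k_nf).

Lemma sharp_kindP k : (k = k_at \/ k = k_af) <-> sharp_kind k.
Proof. by case: k; split=> //; [left|case|right|case]. Qed.

Lemma prefix_anti p q : prefix p q -> prefix q p -> p = q.
Proof.
move=> /prefixP[p' ->] /prefixP[q']; rewrite -catA -[LHS]cats0 => /eqP.
by rewrite eqseq_cat // eqxx /= => /eqP; case: p' => //; rewrite cats0.
Qed.

(** The redex is matched after flattening, so the substitution carries no annotations: those at or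
    below [q] now come from [r] only. Strictly above [q] they survive only if the flag is true. *)
Lemma ann_step_result s q u sg k r l p :
  subterm_at s q = Some u -> flat u = subst sg l -> {subset vars r <= vars l} ->
  ann (step_result s q sg k r) p =
  if prefix q p then sharp_kind k && ann r (drop (size q) p)
  else ann s p && (flag_kind k || ~~ prefix p q).
Proof.
move=> Hu E Hr.
have Hsg x : x \in vars r -> unann (sg x) by move/Hr/(matched_var E) => -[].
have Hsg' x : x \in vars (flat r) -> unann (sg x) by rewrite vars_flat; exact: Hsg.
have Hpq : prefix q p -> prefix p q && (p != q) = false.
  move=> qp; apply/negP => /andP[pq]; rewrite (prefix_anti pq qp); by rewrite eqxx.
have Hne : ~~ prefix q p -> p != q by apply: contraNneq => ->; exact: prefix_refl.
case: (boolP (prefix q p)) => H.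
- by case: k => /=; rewrite ?ann_flat_above (ann_replace _ _ Hu) H ?ann_subst //
    ?ann_flat // Hpq ?andbT.
- by case: k => /=; rewrite ?ann_flat_above (ann_replace _ _ Hu) (negbTE H)
    ?(Hne H) ?andbT.
Qed.

Lemma flat_step_result s q u sg k r l :
  flat u = subst sg l -> {subset vars r <= vars l} ->
  flat (step_result s q sg k r) = replace (flat s) q (subst sg (flat r)).
Proof.
move=> E Hr.
have Hsg x : x \in vars r -> unann (sg x) by move/Hr/(matched_var E) => -[].
have Hsg' x : x \in vars (flat r) -> unann (sg x) by rewrite vars_flat; exact: Hsg.
by case: k => /=; rewrite ?flat_flat_above flat_replace flat_subst // flat_flat.
Qed.

Definition lhs_fun (alpha : adp) := exists f ts, lhs alpha = Fun f false ts.
Definition rhs_vars (alpha : adp) :=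
  forall x r, List.In (x, r) (rhs alpha) -> {subset vars r <= vars (lhs alpha)}.

Lemma nth_In (T : Type) (x0 : T) (s : seq T) i : (i < size s)%N -> List.In (nth x0 s i) s.
Proof. by elim: s i => [|x s IH] [|i] //=; [left|move/IH; right]. Qed.

(** Rephrases a step by its effect on the flattened term, the annotated positions and the
    probability, in place of a case distinction over the four kinds. *)
Lemma chain_step P t0 T v :
  (forall alpha, P alpha -> rhs_vars alpha) ->
  is_chain_tree P t0 T -> ct_node T v -> (0 < ct_kids T v)%N ->
  let alpha := ct_adp T v in let q := ct_pos T v in let s := ct_term T v in
  exists sg,
  [/\ P alpha /\ subterm_at (flat s) q = Some (subst sg (lhs alpha)),
      argNF P (subst sg (lhs alpha)), ct_kids T v = size (rhs alpha),
      sharp_kind (ct_kind T v) = ann s q &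
      forall i, (i < ct_kids T v)%N -> let pr := nth (0, Var 0) (rhs alpha) i in
      [/\ flat (ct_term T (rcons v i)) = replace (flat s) q (subst sg (flat pr.2)),
          forall p, ann (ct_term T (rcons v i)) p =
            if prefix q p then ann s q && ann pr.2 (drop (size q) p)
            else ann s p && (flag alpha || ~~ prefix p q) &
          ct_prob T (rcons v i) = ct_prob T v * pr.1]].
Proof.
move=> HP [_ _ _ _ /(_ v)] H Hv Hk; have [sg [Pa Hok Hsz Hch]] := H Hv Hk.
move=> alpha q s; exists sg.
have [f [a [ts [Hs _ E HNF Hkd]]]] := Hok.
have Hann : sharp_kind (ct_kind T v) = ann s q.
  by rewrite /ann /s /q Hs; case: (ct_kind T v) Hkd => -[_ ->].
have Hflag : flag_kind (ct_kind T v) = flag alpha.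
  by rewrite /alpha; case: (ct_kind T v) Hkd => -[-> _].
split=> //; first by split=> //; rewrite subterm_at_flat Hs /= -E.
move=> i Hi pr; have [-> ->] := Hch i Hi.
have Hr : {subset vars pr.2 <= vars (lhs alpha)}.
  apply: (HP _ Pa pr.1); rewrite -surjective_pairing; apply: nth_In.
  by rewrite -Hsz.
split=> // [|p]; first exact: flat_step_result E Hr.
by rewrite (ann_step_result _ _ Hs E Hr) Hann Hflag.
Qed.

(** Equality up to annotations of the right-hand sides: rewriting of flattened terms cannot tell
    such ADPs apart. *)
Definition same_shape (alpha alpha' : adp) :=
  [/\ lhs alpha' = lhs alpha, flag alpha' = flag alpha &
      [seq (pr.1, flat pr.2) | pr <- rhs alpha'] =
      [seq (pr.1, flat pr.2) | pr <- rhs alpha]].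

Lemma NF_lhs P P' u : (forall alpha, P' alpha -> exists2 beta, P beta & lhs beta = lhs alpha) ->
  NF P u -> NF P' u.
Proof.
move=> H HN [q [w [alpha [sg [/H[beta Pb Eb] [Hw E]]]]]]; apply: HN.
by exists q, w, beta, sg; rewrite Eb.
Qed.

Lemma argNF_lhs P P' u : (forall alpha, P' alpha -> exists2 beta, P beta & lhs beta = lhs alpha) ->
  argNF P u -> argNF P' u.
Proof. by move=> H HN q w Hq Hw; apply: NF_lhs H _; exact: HN Hq Hw. Qed.

(** Applicability of a step and its flattened result depend only on data shared by ADPs of the same
    shape. Positions, substitutions and probabilities are kept; terms and step kinds are recomputed
    from the root. *)
Lemma retree P P' t0 T (A' : seq nat -> adp) :
  (forall alpha, P alpha -> lhs_fun alpha) ->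
  (forall alpha, P alpha -> rhs_vars alpha) ->
  (forall alpha, P' alpha -> exists2 beta, P beta & lhs beta = lhs alpha) ->
  is_chain_tree P t0 T ->
  (forall v, ct_node T v -> (0 < ct_kids T v)%N ->
     P' (A' v) /\ same_shape (ct_adp T v) (A' v)) ->
  exists T', is_chain_tree P' t0 T' /\
    [/\ ct_node T' = ct_node T, ct_prob T' = ct_prob T, ct_kids T' = ct_kids T,
        ct_pos T' = ct_pos T & ct_adp T' = A'].
Proof.
move=> Hl Hv Hlhs HT HA; have [N0 p0 E0 HN HS] := HT.
have /choice[sgf Hsgf] : forall v, exists sg, ct_node T v -> (0 < ct_kids T v)%N ->
    [/\ P (ct_adp T v), step_ok P (ct_term T v) (ct_adp T v) (ct_pos T v) sg (ct_kind T v),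
         ct_kids T v = size (rhs (ct_adp T v)) &
         forall i, (i < ct_kids T v)%N ->
           let pr := nth (0, Var 0) (rhs (ct_adp T v)) i in
           ct_term T (rcons v i) =
             step_result (ct_term T v) (ct_pos T v) sg (ct_kind T v) pr.2 /\
           ct_prob T (rcons v i) = ct_prob T v * pr.1].
  move=> v; have [[Nv Kv]|H] := pselect (ct_node T v /\ (0 < ct_kids T v)%N).
    by have [sg Hsg] := HS v Nv Kv; exists sg.
  by exists Var => Nv Kv; case: H.
pose kd v s := mk_kind (flag (A' v)) (ann s (ct_pos T v)).
(* Children extend an address at its end, so the terms are computed by recursion on the reversed
   address. *)
pose fix tm (rv : seq nat) : term := if rv is i :: rv' then
  step_result (tm rv') (ct_pos T (rev rv')) (sgf (rev rv')) (kd (rev rv') (tm rv'))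
    (nth (0, Var 0) (rhs (A' (rev rv'))) i).2 else t0.
pose T' := CTree (ct_node T) (ct_prob T) (fun v => tm (rev v)) (ct_kids T) A'
  (ct_pos T) (fun v => kd v (tm (rev v))).
exists T'; split; last by [].
have tmS v i : ct_term T' (rcons v i) = step_result (ct_term T' v) (ct_pos T v)
    (sgf v) (ct_kind T' v) (nth (0, Var 0) (rhs (A' v)) i).2.
  by rewrite /= rev_rcons /= revK.
(* Invariant of the replay: both trees agree up to annotations. *)
have Hfl v : ct_node T v -> flat (ct_term T' v) = flat (ct_term T v).
  elim/last_ind: v => [_|v i IH]; first by rewrite /= E0.
  rewrite HN => -[Nv ltik]; have Kv : (0 < ct_kids T v)%N by case: (ct_kids T v) ltik.
  have [Pa [f [a [ts [Hs _ E _ _]]]] Hsz Hch] := Hsgf v Nv Kv.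
  have [P'a [El Ef Er]] := HA v Nv Kv.
  have Hsz' : size (rhs (A' v)) = size (rhs (ct_adp T v)).
    by have /(congr1 size) := Er; rewrite !size_map.
  have Hi : (i < size (rhs (ct_adp T v)))%N by rewrite -Hsz.
  have Er2 : flat (nth (0, Var 0) (rhs (A' v)) i).2 =
             flat (nth (0, Var 0) (rhs (ct_adp T v)) i).2.
    have /(congr1 (fun z => (nth (0, Var 0) z i).2)) := Er.
    by rewrite !(nth_map (0, Var 0)) ?Hsz'.
  have Hr : {subset vars (nth (0, Var 0) (rhs (ct_adp T v)) i).2 <= vars (lhs (ct_adp T v))}.
    apply: (Hv _ Pa (nth (0, Var 0) (rhs (ct_adp T v)) i).1).
    by rewrite -surjective_pairing; exact: nth_In.
  have [-> _] := Hch i ltik; rewrite tmS.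
  rewrite !(flat_step_result _ _ _ E) ?IH ?Er2 //.
  by rewrite -vars_flat Er2 vars_flat.
split=> //.
move=> v Nv Kv; exists (sgf v).
have [Pa [f [a [ts [Hs Hd E HNF Hkd]]]] Hsz Hch] := Hsgf v Nv Kv.
have [P'a [El Ef Er]] := HA v Nv Kv.
have Hsz' : size (rhs (A' v)) = size (rhs (ct_adp T v)).
  by have /(congr1 size) := Er; rewrite !size_map.
split=> //; last 2 first.
- by rewrite /= Hsz Hsz'.
- move=> i ltik; split; first exact: tmS.
  have [_ /= ->] := Hch i ltik.
  have /(congr1 (fun z => (nth (0, Var 0) z i).1)) := Er.
  by rewrite !(nth_map (0, Var 0)) ?Hsz' -?Hsz //= => ->.
have := subterm_at_flat (ct_term T v) (ct_pos T v).
rewrite Hs -Hfl // subterm_at_flat.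
case E' : (subterm_at _ (ct_pos T v)) => [[x|g b us]|] //= -[Eg Eus].
exists g, b, us; split=> //.
(* The replayed redex may have lost its annotation, so its root symbol must be defined; it is the
   root of the matched left-hand side. *)
- left; have [g' [ls El']] := Hl _ Pa.
  exists (A' v), false, ls; split=> //; rewrite El El'; move: E.
  by rewrite El' Eg /= => -[->].
- by rewrite El -E /= Eg Eus.
- by rewrite El; exact: argNF_lhs Hlhs HNF.
- rewrite /kd /ann -/(ct_term T' v) E' /mk_kind.
  by case: (flag (A' v)); case: (b).
Qed.

End ChainTrees.

(** * The dependency graph *)

Section ListIn.
Context {T U : Type}.

Lemma In_map (f : T -> U) s y : List.In y (map f s) <-> exists2 x, List.In x s & f x = y.
Proof.
elim: s => [|x s IH] /=; first by split=> // -[].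
split=> [[<-|/IH[z Hz <-]]|[z [->|Hz] E]]; [by exists x; [left|]|by exists z; [right|]|by left|].
by right; apply/IH; exists z.
Qed.

Lemma In_cat (s1 s2 : seq T) x : List.In x (s1 ++ s2) <-> List.In x s1 \/ List.In x s2.
Proof. by elim: s1 => [|y s1 IH] /=; [split; [right|case]|rewrite IH or_assoc]. Qed.

Lemma In_flatten (ss : seq (seq T)) x :
  List.In x (flatten ss) <-> exists2 s, List.In s ss & List.In x s.
Proof.
elim: ss => [|s ss IH] /=; first by split=> // -[].
rewrite In_cat IH; split=> [[Hx|[s' Hs' Hx]]|[s' [<-|Hs'] Hx]].
- by exists s; [left|].
- by exists s'; [right|].
- by left.
- by right; exists s'.
Qed.

Lemma leq_bigmax_In (f : T -> nat) s x : List.In x s -> (f x <= \max_(y <- s) f y)%N.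
Proof.
elim: s => //= y s IH [<-|/IH H]; rewrite big_cons leq_max ?leqnn //.
by rewrite H orbT.
Qed.

Lemma sub_count_lt (a b : pred T) s x : (forall y, a y -> b y) ->
  List.In x s -> b x -> ~~ a x -> (count a s < count b s)%N.
Proof.
move=> ab; elim: s => //= y s IH [->|Hx] bx ax.
- by rewrite (negbTE ax) bx add0n add1n ltnS; apply: sub_count.
- rewrite -addnS leq_add //; last exact: IH.
  by case ay: (a y) => //; rewrite ab.
Qed.

End ListIn.

(** Serves to enumerate the SCC-prefixes, which are subsets of the finite list of dependency
    pairs. *)
Lemma finite_powerlist (T : Type) (s : seq T) :
  exists ss : seq (set T), forall A, (forall x, A x -> List.In x s) -> List.In A ss.
Proof.
elim: s => [|x s [ss IH]].
  exists [:: set0] => A HA; left; apply/esym; rewrite -subset0 => y /HA[].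
exists (ss ++ map (fun A => A `|` [set x]) ss) => A HA; apply/In_cat.
have [Ax|nAx] := pselect (A x).
- right; apply/In_map; have [As|nAs] := pselect (List.In x s).
    exists A; first by apply: IH => y /HA[<-|].
    by apply/seteqP; split=> y; [case=> // ->|left].
  exists (A `\ x); first by apply: IH => y [/HA[->|//] /(_ erefl)].
  apply/seteqP; split=> y; first by case=> [[]|->].
  by have [->|H] := pselect (y = x); [right|left].
- left; apply: IH => y Ay; have [E|//] := HA _ Ay.
  by rewrite -E in Ay.
Qed.

Lemma In_mem (T : eqType) (s : seq T) x : x \in s -> List.In x s.
Proof. by elim: s => //= y s IH; rewrite inE => /orP[/eqP ->|/IH]; [left|right]. Qed.

Lemma finite_set_list (T : Type) (A : set T) : finite_set A ->
  exists s : seq T, forall x, A x -> List.In x s.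
Proof.
move=> /(@finite_seqP {classic T})[s ->]; exists s => x /=; exact: In_mem.
Qed.

(** * Restriction of ADPs to a set of dependency pairs *)

Section Restriction.
Context {Sg : signature}.
Local Notation term := (term Sg).
Local Notation adp := (adp Sg).
Implicit Types (P S : set adp) (J : set (dpair (Sg := Sg))) (D : sym Sg -> Prop).

Lemma restrict_shape D J (alpha : adp) : same_shape alpha (restrict D J alpha).
Proof.
split=> //=; rewrite -map_comp; apply: onth_ext => i; rewrite !onth_mapE.
by case: onth => //= pr; rewrite flat_sharp_Phi.
Qed.

(** Meaningful when [ann r p] holds: for [r] in a right-hand side of [alpha], it is then the
    dependency pair belonging to this annotation. *)
Definition new_dp (alpha : adp) (r : term) p : dpair :=
  (sharp_root (lhs alpha), omap (fun u => sharp_root (flat u)) (subterm_at r p)).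

Lemma ann_restrict D J (alpha : adp) i p :
  let r := (nth (0, Var 0) (rhs alpha) i).2 in
  let rJ := (nth (0, Var 0) (rhs (restrict D J alpha)) i).2 in
  (ann rJ p -> ann r p) /\ (ann r p -> J (new_dp alpha r p) -> ann rJ p).
Proof.
have [Hi|Hi] := ltnP i (size (rhs alpha)); last first.
  (* An index out of range yields [Var 0] on both sides, which has no annotation. *)
  by rewrite !nth_default ?size_map //= /ann; case: p.
rewrite /restrict /= (nth_map (0, Var 0)) //=; set pr := nth _ _ _.
rewrite ann_sharp_Phi; split.
- case: subterm_at => [[//|f a ts]|//]; case: asboolP => //.
  by case=> -[t [_ /ann_sub_ann]].
- move=> /annP[f [ts E]]; rewrite /new_dp E /= => HJ.
  apply/asboolP; split; last by right.
  by exists (flat (Fun f true ts)); split=> //; exists f, ts.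
Qed.

Lemma lhs_restrict_set P J X (alpha : adp) : restrict_set P J X alpha ->
  exists2 beta, X beta & lhs beta = lhs alpha.
Proof. by case=> beta Xb <-; exists beta. Qed.

Lemma lhs_restrict_set_inv P J X (alpha : adp) : X alpha ->
  exists2 beta, restrict_set P J X beta & lhs beta = lhs alpha.
Proof. by move=> Xa; exists (restrict (defined P) J alpha) => //; exists alpha. Qed.

Lemma defined_restrict P J f : defined (restrict_set P J P) f <-> defined P f.
Proof.
split=> -[alpha [a [ts [Pa E]]]].
- by have [beta Pb Eb] := lhs_restrict_set Pa; exists beta, a, ts; rewrite Eb.
- by have [beta Pb Eb] := lhs_restrict_set_inv P J Pa; exists beta, a, ts; rewrite Eb.
Qed.

Lemma basic_restrict P J t : basic (restrict_set P J P) t <-> basic P t.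
Proof.
split=> -[f [ts [-> Df wf H]]]; exists f, ts; split=> //; try exact/(defined_restrict P J).
- by move=> u /H[Hu Hq]; split=> // q g a us /Hq Hn /(defined_restrict P J).
- by move=> u /H[Hu Hq]; split=> // q g a us /Hq Hn /(defined_restrict P J).
Qed.

Lemma restrict_lhs_fun P J X : (forall alpha, X alpha -> lhs_fun alpha) ->
  forall alpha, restrict_set P J X alpha -> lhs_fun alpha.
Proof. by move=> H alpha [beta /H[f [ts E]] <-]; exists f, ts. Qed.

Lemma In_nth (T : Type) (x0 : T) s x : List.In x s ->
  exists2 i, (i < size s)%N & nth x0 s i = x.
Proof.
elim: s => //= y s IH [->|/IH[i Hi E]]; first by exists 0%N.
by exists i.+1.
Qed.

Lemma shape_rhs_vars (alpha beta : adp) : same_shape alpha beta ->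
  rhs_vars alpha -> rhs_vars beta.
Proof.
move=> [El _ Er] H x r /(@In_nth _ (0, Var 0))[i Hi E].
have Hsz : size (rhs beta) = size (rhs alpha).
  by have /(congr1 size) := Er; rewrite !size_map.
have /(congr1 (fun z => (nth (0, Var 0) z i).2)) := Er.
rewrite !(nth_map (0, Var 0)) -?Hsz // E /= => Ef.
rewrite El -vars_flat Ef vars_flat.
apply: (H (nth (0, Var 0) (rhs alpha) i).1).
by rewrite -surjective_pairing; apply: nth_In; rewrite -Hsz.
Qed.

Lemma restrict_rhs_vars P J X : (forall alpha, X alpha -> rhs_vars alpha) ->
  forall alpha, restrict_set P J X alpha -> rhs_vars alpha.
Proof.
by move=> H alpha [beta /H Hb <-]; exact: shape_rhs_vars (restrict_shape _ _ _) Hb.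
Qed.

End Restriction.

(** * Cycles, SCC-prefixes and ranks in the dependency graph *)

Section Graph.
Context {Sg : signature}.
Local Notation term := (term Sg).
Local Notation adp := (adp Sg).
Local Notation dpair := (dpair (Sg := Sg)).
Variable P : set adp.
Implicit Types (d e x y : dpair) (h : seq dpair) (G J K : set dpair).

Definition on_cycle e := clos_trans _ (dg_edge P) e e.
Definition reaches_cycle d := exists2 e, reach P d e & on_cycle e.

Lemma rt_t_trans x y z : reach P x y -> clos_trans _ (dg_edge P) y z ->
  clos_trans _ (dg_edge P) x z.
Proof.
by elim=> {x y} [x y xy yz|//|x y w _ IH1 _ IH2 /IH2/IH1//]; apply: t_trans yz; exact: t_step.
Qed.

Lemma t_rt_trans x y z : clos_trans _ (dg_edge P) x y -> reach P y z ->
  clos_trans _ (dg_edge P) x z.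
Proof.
move=> + yz; elim: yz x => {y z} [y z yz x|//|y z w _ IH1 _ IH2 x /IH1/IH2//].
by move=> xy; apply: t_trans xy _; exact: t_step.
Qed.

Lemma t_rt x y : clos_trans _ (dg_edge P) x y -> reach P x y.
Proof. by elim=> {x y} [x y|x y z _ xy _]; [exact: rt_step|exact: rt_trans]. Qed.

Lemma clos_trans_dpP x y : clos_trans _ (dg_edge P) x y -> dpP P x /\ dpP P y.
Proof. by elim=> {x y} [x y [? []]|x y z _ [? _] _ []]. Qed.

Definition component e : set dpair := [set x | reach P e x /\ reach P x e].

(** Every node on a path between two members is reached from [e] and reaches [e], so the path stays
    in the component. A strongly connected superset contains [e], hence all its elements lie on
    paths from and to [e]. *)
Lemma component_SCC e : on_cycle e -> SCC P (component e).
Proof.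
move=> ee; have comp_t x y : component e x -> component e y ->
    clos_trans _ (dg_edge P) x y.
  by move=> [_ xe] [ey _]; exact: rt_t_trans xe (t_rt_trans ee ey).
split.
- by move=> x ex; have [] := clos_trans_dpP (comp_t _ _ ex ex).
- move=> x y Gx Gy; have := comp_t _ _ Gx Gy.
  have [[ex _] [_ ye]] := (Gx, Gy) => xy; elim: xy ex ye => {x y Gx Gy}.
  + move=> x y xy ex ye; apply: t_step; split=> //; split=> //.
    * by apply: rt_trans ye; exact: rt_step.
    * by apply: rt_trans ex _; exact: rt_step.
  + move=> x y z xy IHxy yz IHyz ex ze.
    apply: t_trans (IHxy ex _) (IHyz _ ze).
    * by apply: rt_trans ze; exact: t_rt.
    * by apply: rt_trans ex _; exact: t_rt.
- move=> G' GG' _ Hc; apply/seteqP; split=> // x G'x.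
  have G'e : G' e by apply: GG'; split; exact: rt_refl.
  have Hp a b : clos_trans _ (fun x y => [/\ G' x, G' y & dg_edge P x y]) a b -> reach P a b.
    by elim=> {a b} [a b [_ _]|a b c _ ab _]; [exact: rt_step|exact: rt_trans].
  by split; apply: Hp; exact: Hc.
Qed.

(** The list runs against the edges: its head is the newest pair. *)
Fixpoint dg_path h : Prop :=
  if h is d :: h' then
    [/\ dpP P d, (if h' is d' :: _ then dg_edge P d' d else True) & dg_path h']
  else True.

Lemma dg_path_reach d h x : dg_path (d :: h) -> List.In x (d :: h) -> reach P x d.
Proof.
elim: h d => [|d' h IH] d; first by move=> _ [->|[]]; exact: rt_refl.
move=> [_ dd' Hp] [->|Hx]; first exact: rt_refl.
by apply: rt_trans (IH _ Hp Hx) _; exact: rt_step.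
Qed.

Lemma dg_path_comparable h x y : dg_path h -> List.In x h -> List.In y h ->
  reach P x y \/ reach P y x.
Proof.
elim: h => // d h IH Hp [<-|Hx] Hy; first by right; exact: dg_path_reach Hp Hy.
case: Hy => [<-|Hy]; first by left; apply: dg_path_reach Hp _; right.
by apply: IH => //; case: Hp.
Qed.

Lemma dg_path_dpP h x : dg_path h -> List.In x h -> dpP P x.
Proof. by elim: h => // d h IH [Pd _ Hp] [<-|/IH]; [|apply]. Qed.

Section Enumerated.
Variable L : seq dpair.
Hypothesis HL : forall x, dpP P x -> List.In x L.

(** Each proper enlargement of [K] decreases the number of entries of [L] outside it, so enlarging
    must stop. *)
Lemma prefix_maximal G K : prefix_ok P G K ->
  exists J, [/\ K `<=` J, prefix_ok P G J &
    forall K', J `<=` K' -> prefix_ok P G K' -> K' = J].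
Proof.
move: {2}(count _ _) (leqnn (count (fun x => `[< ~ K x >]) L)) => n.
elim: n K => [|n IH] K Hn HK.
all: have [Hm|] := pselect (forall K', K `<=` K' -> prefix_ok P G K' -> K' = K).
1,3: by exists K; split.
all: move/existsNP => [K' /not_implyP[KK' /not_implyP[HK' neq]]].
all: have [x K'x nKx] : exists2 x, K' x & ~ K x.
1,3: apply: contrapT => H; apply: neq; apply/seteqP; split=> // x K'x;
     by apply: contrapT => nKx; apply: H; exists x.
all: have Hlt : (count (fun x => `[< ~ K' x >]) L < count (fun x => `[< ~ K x >]) L)%N.
1,3: have [HP _ _] := HK'; apply: (@sub_count_lt _ _ _ _ x) (HL (HP _ K'x)) _ _;
     [by move=> y /asboolP H; apply/asboolP => /KK' | exact/asboolP
     |by apply/negP => /asboolP].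
- by have := leq_trans Hlt Hn.
- have [|J [K'J HJ Jm]] := IH K' _ HK'; first by rewrite -ltnS; exact: leq_trans Hlt Hn.
  by exists J; split=> //; exact: subset_trans K'J.
Qed.

(** The path together with the component of a reachable cycle satisfies [prefix_ok]: pairs on a path
    are comparable, and each of them reaches the newest one and thus the whole component. A maximal
    enlargement is the prefix sought. *)
Lemma path_in_prefix d h : dg_path (d :: h) -> reaches_cycle d ->
  exists2 J, SCC_prefix P J & forall x, List.In x (d :: h) -> J x.
Proof.
move=> Hp [e de ee]; pose G := component e.
have [GP Gc Gm] := component_SCC ee.
have Ge : G e by split; exact: rt_refl.
pose K : set dpair := [set x | List.In x (d :: h) \/ G x].
have Hre x : List.In x (d :: h) -> reach P x e.
  by move=> Hx; apply: rt_trans de; exact: dg_path_reach Hp Hx.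
have [|J [KJ HJ Jm]] := @prefix_maximal G K.
  split.
  - by move=> x [/(dg_path_dpP Hp)|/GP].
  - by move=> x [/Hre xe|Gx]; [exists e|exists x; split=> //; exact: rt_refl].
  - move=> x y [Hx|[ex xe]] [Hy|[ey ye]].
    + exact: dg_path_comparable Hp Hx Hy.
    + by left; exact: rt_trans (Hre _ Hx) ey.
    + by right; exact: rt_trans (Hre _ Hy) ex.
    + by left; exact: rt_trans xe ey.
exists J; last by move=> x Hx; apply: KJ; left.
exists G; split=> //.
by move=> x Gx; apply: KJ; right.
Qed.

Definition rank d := count (fun e => `[< reach P d e >]) L.

(** Whatever [e] reaches is reached by [d], but [e] does not reach [d], since [d] would then lie on
    a cycle. *)
Lemma rank_edge d e : dg_edge P d e -> ~ reaches_cycle d -> (rank e < rank d)%N.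
Proof.
move=> de nd; apply: (@sub_count_lt _ _ _ _ d).
- move=> y /asboolP ey; apply/asboolP; apply: rt_trans ey; exact: rt_step.
- by apply: HL; case: de.
- by apply/asboolP; exact: rt_refl.
- apply/negP => /asboolP ed; apply: nd; exists d; first exact: rt_refl.
  exact: t_rt_trans (t_step _ _ _ _ de) ed.
Qed.

Lemma rank_gt0 d : List.In d L -> (0 < rank d)%N.
Proof.
move=> Ld; rewrite /rank -(count_pred0 L); apply: sub_count_lt Ld _ _ => //.
by apply/asboolP; exact: rt_refl.
Qed.

Lemma rank_size d : (rank d <= size L)%N.
Proof. exact: count_size. Qed.

End Enumerated.
End Graph.

(** * Histories of annotations *)

Section History.
Context {Sg : signature}.
Local Notation term := (term Sg).
Local Notation adp := (adp Sg).
Local Notation dpair := (dpair (Sg := Sg)).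
Implicit Types (J : set dpair) (T : ctree (Sg := Sg)) (p q v : seq nat).

Fixpoint hist_rev T (rv : seq nat) p : seq dpair :=
  if rv is i :: rv' then
    let v := rev rv' in
    let q := ct_pos T v in
    if prefix q p then
      new_dp (ct_adp T v) (nth (0, Var 0) (rhs (ct_adp T v)) i).2 (drop (size q) p)
        :: hist_rev T rv' q
    else hist_rev T rv' p
  else [::].

(* The dependency pairs that created the annotation at [p] in the node [v], newest first;
   it is empty for the annotation of the initial term. *)
Definition hist T v p := hist_rev T (rev v) p.

Lemma hist_rcons T v i p : hist T (rcons v i) p =
  if prefix (ct_pos T v) p then
    new_dp (ct_adp T v) (nth (0, Var 0) (rhs (ct_adp T v)) i).2 (drop (size (ct_pos T v)) p)
      :: hist T v (ct_pos T v)
  else hist T v p.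
Proof. by rewrite /hist rev_rcons /= revK. Qed.

Variable P : set adp.

(* [w] is the subterm below an annotation with history [h]: since the annotation was created,
   only flag-true ADPs were applied below it, so [w] evolved by np(P)-steps. Rewriting it
   thus adds an edge of the dependency graph. *)
Definition lineage (h : seq dpair) (w : term) : Prop :=
  dg_path P h /\
  if h is d :: _ then exists u sg,
    [/\ d.2 = Some u, plain_subst sg, argNF P (subst sg d.1) &
        clos_refl_trans _ (itrs_step (np P)) (subst sg u) (sharp_root w)]
  else True.

Hypothesis Pvalid : forall alpha, P alpha -> valid_adp (defined P) alpha.

Lemma valid_lhs_fun alpha : P alpha -> lhs_fun alpha.
Proof. by case/Pvalid. Qed.

Lemma valid_rhs_vars alpha : P alpha -> rhs_vars alpha.
Proof. by case/Pvalid => _ _ _ H _ x r /H[]. Qed.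

(** Chain trees are innermost with respect to [P], edges with respect to [np P]. The left-hand sides
    of [np P] are among those of [P]. *)
Lemma NF_np u : unann u -> NF P u -> NF_trs (np P) u.
Proof.
move=> uu HN [q [w [l [r [sg [[alpha [x [r' [Pa _ _ [El _]]]]] [Hw E]]]]]]]; apply: HN.
exists q, w, alpha, sg; split=> //; split=> //.
by rewrite flat_unann -?El //; exact: unann_subterm uu Hw.
Qed.

(** The position is nonempty, so the step leaves the annotated root alone. *)
Lemma np_step_below alpha x r sg w i p :
  P alpha -> flag alpha -> List.In (x, r) (rhs alpha) -> unann w ->
  subterm_at w (i :: p) = Some (subst sg (lhs alpha)) -> argNF P (subst sg (lhs alpha)) ->
  itrs_step (np P) (sharp_root w) (sharp_root (replace w (i :: p) (subst sg (flat r)))).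
Proof.
move=> Pa fa Hr uw Hw HN; exists (i :: p), (lhs alpha), (flat r), sg; split.
- by exists alpha, x, r.
- by rewrite subterm_at_sharp_root.
- move=> q u Hq Hu; apply: NF_np (HN _ _ Hq Hu).
  exact: unann_subterm (unann_subterm uw Hw) Hu.
- by rewrite sharp_root_replace.
Qed.

(** [plain_subst] constrains all variables, whereas matching controls only those of the left-hand
    side; the others are sent to [Var 0]. *)
Definition plain_restriction sg (t : term) : nat -> term :=
  fun x => if x \in vars t then sg x else Var 0.

Lemma plain_restrictionE sg t u : {subset vars u <= vars t} ->
  subst (plain_restriction sg t) u = subst sg u.
Proof. by move=> H; apply: eq_subst => x /H; rewrite /plain_restriction => ->. Qed.

Lemma vars_sharp_root (t : term) : vars (sharp_root t) = vars t.
Proof. by case: t. Qed.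

Lemma argNF_sharp_root (t : term) : argNF P t -> argNF P (sharp_root t).
Proof. by move=> H [//|i q] u _; rewrite subterm_at_sharp_root; exact: H. Qed.

(** The derivation recorded by [h] has arrived at the annotated instance of the left-hand side,
    which is what an edge to the new pair requires. The new pair starts with a derivation of length
    zero. *)
Lemma lineage_new h s q sg alpha x r p :
  P alpha -> List.In (x, r) (rhs alpha) -> wf_term s ->
  subterm_at (flat s) q = Some (subst sg (lhs alpha)) ->
  argNF P (subst sg (lhs alpha)) ->
  lineage h (subst sg (lhs alpha)) -> ann r p -> exists w,
  subterm_at (subst sg (flat r)) p = Some w /\ lineage (new_dp alpha r p :: h) w.
Proof.
move=> Pa Hr wfs Hq HN [Hp Hh] /annP[f [ts Er]].
have Ef : subterm_at (flat r) p = Some (flat (Fun f true ts)) by rewrite subterm_at_flat Er.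
exists (subst sg (flat (Fun f true ts))); split; first exact: subterm_at_subst Ef.
have [g [ls El]] := valid_lhs_fun Pa.
pose sg' := plain_restriction sg (lhs alpha).
have Hsg y : y \in vars (lhs alpha) -> unann (sg y) /\ wf_term (sg y).
  move=> yl; move: Hq; rewrite subterm_at_flat; case E: (subterm_at s q) => [u|] //= -[Eu].
  by have [? H] := matched_var Eu yl; split=> //; apply: H; exact: wf_subterm wfs E.
have plain' : plain_subst sg'.
  by move=> y; rewrite /sg' /plain_restriction; case: ifP => // /Hsg.
have Elhs : subst sg' (sharp_root (lhs alpha)) = sharp_root (subst sg (lhs alpha)).
  by rewrite plain_restrictionE ?vars_sharp_root // El.
have HN' : argNF P (subst sg' (sharp_root (lhs alpha))).
  by rewrite Elhs; exact: argNF_sharp_root.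
have dpd : dpP P (new_dp alpha r p).
  exists alpha; split=> //; left; exists x, r, (flat (Fun f true ts)), p; split=> //.
  - by exists f, ts.
  - by rewrite /new_dp Er.
split.
- split=> //; case: h Hp Hh => // d h Hp [u [sg1 [Ed Hpl HN1 Hst]]].
  have [Pd _ _] := Hp; split=> //; split=> //.
  by exists u, sg1, sg'; split=> //; rewrite Elhs.
- exists (sharp_root (flat (Fun f true ts))), sg'; split=> //.
  + by rewrite /new_dp Er.
  + rewrite plain_restrictionE; first exact: rt_refl.
    rewrite vars_sharp_root => y /(vars_subterm Ef); rewrite vars_flat.
    exact: (valid_rhs_vars Pa Hr).
Qed.

Lemma hist_lineage t0 T v : is_chain_tree P t0 T -> wf_term t0 -> ct_node T v ->
  wf_term (ct_term T v) /\
  forall p, ann (ct_term T v) p -> exists w,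
    subterm_at (flat (ct_term T v)) p = Some w /\ lineage (hist T v p) w.
Proof.
move=> HT wf0; have [N0 _ E0 HN _] := HT.
elim/last_ind: v => [_|v i IH]; rewrite ?HN.
  rewrite E0; split=> // p /annP[f [ts E]].
  by exists (flat (Fun f true ts)); rewrite subterm_at_flat E.
move=> [Nv ltik]; have Kv : (0 < ct_kids T v)%N by case: (ct_kids T v) ltik.
have [wfs Hs] := IH Nv.
have [sg [[Pa Hq] HNF Hsz _ Hch]] := chain_step valid_rhs_vars HT Nv Kv.
have [Efl Eann _] := Hch i ltik; rewrite Hsz in ltik.
set alpha := ct_adp T v in Pa Hq HNF Hsz Hch Efl Eann ltik *.
set q := ct_pos T v in Hq Hch Efl Eann.
set s := ct_term T v in Hq Hs wfs Hch Efl Eann.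
set pr := nth _ _ _ in Efl Eann.
have Hpr : List.In (pr.1, pr.2) (rhs alpha) by rewrite -surjective_pairing; exact: nth_In.
have [_ _ _ /(_ _ _ Hpr)[wfr varr _ _ _] _] := Pvalid Pa.
split.
  rewrite -wf_flat Efl; apply: wf_replace; first by rewrite wf_flat.
  apply: wf_subst; first by rewrite wf_flat.
  rewrite vars_flat => x /varr xl; move: Hq; rewrite subterm_at_flat.
  case E: (subterm_at s q) => [u|] //= -[Eu].
  by have [_] := matched_var Eu xl; apply; exact: wf_subterm wfs E.
move=> p; rewrite Eann hist_rcons -/q -/alpha -/pr.
case: ifP => [/prefixP[p' ->]|nqp].
  move=> /andP[sq]; rewrite drop_size_cat // => rp'.
  have [w [Hw Hlin]] := Hs q sq; move: Hw; rewrite Hq => -[Ew].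
  rewrite -Ew in Hlin.
  have [w' [Hw' Hlin']] := lineage_new Pa Hpr wfs Hq HNF Hlin rp'.
  by exists w'; rewrite Efl (subterm_at_replace_below _ _ Hq).
move=> /andP[sp Hfl]; have [w [Hw Hlin]] := Hs p sp.
(* A redex parallel to [p] leaves both the subterm and its history unchanged. *)
have [/prefixP[q' Eq]|npq] := boolP (prefix p q); last first.
  by exists w; rewrite Efl subterm_at_replace_parallel ?nqp.
(* An annotation strictly above the redex survives only a step with flag true, and exactly such
   steps belong to [np P]. *)
have fa : flag alpha by case/orP: Hfl => // /negP; rewrite Eq prefix_prefix.
case: q' Eq => [|j q'] Eq; first by move: nqp; rewrite Eq cats0 prefix_refl.
have Hwq : subterm_at w (j :: q') = Some (subst sg (lhs alpha)).
  by move: Hq; rewrite Eq subterm_at_cat Hw.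
exists (replace w (j :: q') (subst sg (flat pr.2))); split.
  by rewrite Efl Eq; exact: subterm_at_replace_above Hw.
have uw : unann w by exact: unann_subterm (unann_flat s) Hw.
have [Hp Hh] := Hlin; split=> //.
case: (hist T v p) Hh => // d h [u [sg1 [Ed Hpl HN1 Hst]]].
exists u, sg1; split=> //; apply: rt_trans Hst _; apply: rt_step.
exact: np_step_below Hpr uw Hwq HNF.
Qed.

(* Replaying [T] with restricted ADPs keeps every annotation whose history lies in [J]. *)
Lemma restricted_tree J t0 T : is_chain_tree P t0 T ->
  exists TJ, is_chain_tree (restrict_set P J P) t0 TJ /\
  [/\ ct_node TJ = ct_node T, ct_prob TJ = ct_prob T, ct_kids TJ = ct_kids T,
      forall v, ct_adp TJ v = restrict (defined P) J (ct_adp T v) &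
      forall v, ct_node T v -> (0 < ct_kids T v)%N -> sharp_kind (ct_kind T v) ->
        (forall d, List.In d (hist T v (ct_pos T v)) -> J d) -> sharp_kind (ct_kind TJ v)].
Proof.
move=> HT; have [N0 _ E0 HN HS] := HT.
have [TJ [HTJ [En Ep Ek Eq Ea]]] := @retree _ P (restrict_set P J P) t0 T
  (fun v => restrict (defined P) J (ct_adp T v)) valid_lhs_fun valid_rhs_vars
  (@lhs_restrict_set _ P J P) HT (fun v Nv Kv => let: ex_intro _ H := HS v Nv Kv in
     let: And4 Pa _ _ _ := H in
     conj (ex_intro2 _ _ (ct_adp T v) Pa erefl) (restrict_shape _ _ _)).
have Hv := @restrict_rhs_vars _ P J P valid_rhs_vars.
have Hann v : ct_node T v -> forall p, ann (ct_term T v) p ->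
    (forall d, List.In d (hist T v p) -> J d) -> ann (ct_term TJ v) p.
  elim/last_ind: v => [_|v i IH]; rewrite ?HN.
    by have [_ _ -> _ _] := HTJ; rewrite E0.
  move=> [Nv ltik]; have Kv : (0 < ct_kids T v)%N by case: (ct_kids T v) ltik.
  have [sg [_ _ Hsz _ /(_ i ltik)[_ Eann _]]] := chain_step valid_rhs_vars HT Nv Kv.
  have [||sgJ [_ _ _ _ /(_ i)[|_ EannJ _]]] := @chain_step _ _ t0 TJ v Hv HTJ;
    rewrite ?En ?Ek //.
  move=> p; rewrite Eann EannJ hist_rcons Eq Ea; case: ifP => qp.
  - move=> /andP[sq rp] HJ; rewrite IH //=; last by move=> d Hd; apply: HJ; right.
    by have [_] := @ann_restrict _ (defined P) J (ct_adp T v) i (drop (size (ct_pos T v)) p);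
      apply => //; apply: HJ; left.
  - by move=> /andP[sp Hfl] HJ; rewrite IH.
exists TJ; split=> //; split=> // [v|v Nv Kv]; first by rewrite Ea.
have [_ [_ _ _ -> _]] := chain_step valid_rhs_vars HT Nv Kv.
have [||_ [_ _ _ -> _]] := @chain_step _ _ t0 TJ v Hv HTJ; rewrite ?En ?Ek //.
by rewrite Eq; exact: Hann.
Qed.

(** The converse replay: each restricted ADP is replaced by a preimage in [P]. This can only add
    annotations, so annotated steps stay annotated. *)
Lemma lifted_tree J t0 T : is_chain_tree (restrict_set P J P) t0 T ->
  exists T', is_chain_tree P t0 T' /\
  [/\ ct_node T' = ct_node T, ct_prob T' = ct_prob T, ct_kids T' = ct_kids T &
      forall v, ct_node T v -> (0 < ct_kids T v)%N ->
        [/\ P (ct_adp T' v), ct_adp T v = restrict (defined P) J (ct_adp T' v) &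
            sharp_kind (ct_kind T v) -> sharp_kind (ct_kind T' v)]].
Proof.
move=> HT; have [N0 _ E0 HN HS] := HT.
have /choice[A' HA'] : forall v, exists alpha, ct_node T v -> (0 < ct_kids T v)%N ->
    P alpha /\ restrict (defined P) J alpha = ct_adp T v.
  move=> v; have [[Nv Kv]|H] := pselect (ct_node T v /\ (0 < ct_kids T v)%N).
    by have [_ [[alpha Pa E] _ _ _]] := HS v Nv Kv; exists alpha.
  by exists (ct_adp T v) => Nv Kv; case: H.
have Hv := @restrict_rhs_vars _ P J P valid_rhs_vars.
have [||v Nv Kv|T' [HT' [En Ep Ek Eq Ea]]] := @retree _ _ P t0 T A' _ Hv _ HT.
- exact: restrict_lhs_fun valid_lhs_fun.
- by move=> alpha Pa; exact: lhs_restrict_set_inv.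
- have [Pa <-] := HA' v Nv Kv; split=> //.
  by have [? ? ?] := restrict_shape (defined P) J (A' v); split; apply/esym.
have Hann v : ct_node T v -> forall p, ann (ct_term T v) p -> ann (ct_term T' v) p.
  elim/last_ind: v => [_|v i IH]; rewrite ?HN.
    by have [_ _ -> _ _] := HT'; rewrite E0.
  move=> [Nv ltik]; have Kv : (0 < ct_kids T v)%N by case: (ct_kids T v) ltik.
  have [_ [_ _ _ _ /(_ i ltik)[_ Eann _]]] := chain_step Hv HT Nv Kv.
  have [||_ [_ _ _ _ /(_ i)[|_ Eann' _]]] := @chain_step _ _ t0 T' v valid_rhs_vars HT';
    rewrite ?En ?Ek //.
  have [Pa Er] := HA' v Nv Kv.
  move=> p; rewrite Eann Eann' Eq Ea -Er; case: ifP => qp /andP[].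
  - move=> /IH -> //=; exact: (@ann_restrict _ (defined P) J (A' v) i _).1.
  - by move=> /IH -> //.
exists T'; split=> //; split=> // v Nv Kv; have [Pa Er] := HA' v Nv Kv.
rewrite Ea; split=> //.
have [_ [_ _ _ -> _]] := chain_step Hv HT Nv Kv.
have [||_ [_ _ _ -> _]] := @chain_step _ _ t0 T' v valid_rhs_vars HT'; rewrite ?En ?Ek //.
by rewrite Eq; exact: Hann.
Qed.

End History.

(** * Counting annotated steps *)

Lemma leq_sum_subset (I : eqType) (s s' : seq I) (F : I -> nat) :
  uniq s -> {subset s <= s'} -> (\sum_(x <- s) F x <= \sum_(x <- s') F x)%N.
Proof.
elim: s s' => [|x s IH] s' /=; first by rewrite big_nil.
move=> /andP[xs us] Hs; have xs' : x \in s' by apply: Hs; rewrite mem_head.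
rewrite big_cons (big_rem x xs') /= leq_add2l IH // => y ys.
by apply: rem_mem; [apply: contraNneq xs => <-|apply: Hs; rewrite inE ys orbT].
Qed.

Lemma ler_sum_subset (I : eqType) (s s' : seq I) (F : I -> R) :
  uniq s -> {subset s <= s'} -> (forall x, x \in s' -> 0 <= F x) ->
  \sum_(x <- s) F x <= \sum_(x <- s') F x.
Proof.
elim: s s' => [|x s IH] s' /=.
  by move=> _ _ H; rewrite big_nil big_seq; exact: sumr_ge0.
move=> /andP[xs us] Hs H; have xs' : x \in s' by apply: Hs; rewrite mem_head.
rewrite big_cons (big_rem x xs') /= lerD2l IH //.
- move=> y ys.
  by apply: rem_mem; [apply: contraNneq xs => <-|apply: Hs; rewrite inE ys orbT].
- by move=> y /mem_rem; exact: H.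
Qed.

(** * Finite truncations of a chain tree *)

Section Levels.
Context {Sg : signature}.
Local Notation term := (term Sg).
Local Notation adp := (adp Sg).
Variables (P : set adp) (t0 : term) (T : ctree (Sg := Sg)).
Hypothesis HT : is_chain_tree P t0 T.

Fixpoint level n : seq (seq nat) :=
  if n is n'.+1 then [seq rcons v i | v <- level n', i <- iota 0 (ct_kids T v)]
  else [:: [::]].

Fixpoint nodes n : seq (seq nat) := if n is n'.+1 then nodes n' ++ level n' else [::].

Lemma mem_level n v : v \in level n <-> ct_node T v /\ size v = n.
Proof.
have [N0 _ _ HN _] := HT; elim: n v => [|n IH] v /=.
  by rewrite inE; split=> [/eqP ->|[_ /size0nil ->]].
split=> [/allpairsPdep[u [i [/IH[Nu <-]]]]|].
  by rewrite mem_iota add0n => /= lti ->; rewrite HN size_rcons.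
case/lastP: v => [[]//|v i]; rewrite HN size_rcons => -[[Nv lti] [/esym sv]].
by apply/allpairsPdep; exists v, i; rewrite mem_iota /= add0n lti; split=> //; apply/IH.
Qed.

Lemma level_uniq n : uniq (level n).
Proof.
elim: n => //= n IH; apply: allpairs_uniq_dep => //.
- by move=> v _; exact: iota_uniq.
- move=> [v i] [w j] _ _ /= /eqP; rewrite eqseq_rcons => /andP[/eqP -> /eqP ->] //.
Qed.

Lemma mem_nodes n v : v \in nodes n <-> ct_node T v /\ (size v < n)%N.
Proof.
elim: n => [|n IH] /=; first by split=> // -[].
rewrite mem_cat ltnS leq_eqVlt; split=> [/orP[/IH[Nv ->]|/mem_level[Nv ->]]|].
- by rewrite orbT.
- by rewrite eqxx.
- move=> [Nv /orP[/eqP sv|sv]]; apply/orP; first by right; apply/mem_level.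
  by left; apply/IH.
Qed.

Lemma nodes_uniq n : uniq (nodes n).
Proof.
elim: n => //= n IH; rewrite cat_uniq IH level_uniq andbT /=.
apply/hasPn => v /mem_level[_ sv]; apply/negP => /mem_nodes[_].
by rewrite sv ltnn.
Qed.

Hypothesis prob_ge0 : forall v, ct_node T v -> 0 <= ct_prob T v.

(** Every finite set of nodes has bounded depth, so it lies in some truncation [nodes n]. *)
Lemma esum_nodes_le (D : pred (seq nat)) (M : \bar R) :
  (forall n, ((\sum_(v <- nodes n | D v) ct_prob T v)%:E <= M)%E) ->
  (\esum_(v in [set v | ct_node T v /\ D v]) (ct_prob T v)%:E <= M)%E.
Proof.
move=> H; apply: ge_ereal_sup => _ [X [finX XD] <-].
rewrite fsbig_finite //= sumEFin.
pose n := (\max_(v <- finmap.enum_fset (fset_set X)) size v).+1.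
apply: le_trans (H n); rewrite lee_fin -[leRHS]big_filter; apply: ler_sum_subset.
- exact: finmap.fset_uniq.
- move=> v vX; rewrite mem_filter; have /XD[Nv ->] : X v.
    by move: vX; rewrite in_fset_set // inE.
  by apply/mem_nodes; split=> //; rewrite ltnS; apply: leq_bigmax_In; exact: In_mem.
- by move=> v; rewrite mem_filter => /andP[_ /mem_nodes[Nv _]]; exact: prob_ge0.
Qed.

Lemma nodes_le_esum (D : pred (seq nat)) n :
  ((\sum_(v <- nodes n | D v) ct_prob T v)%:E <=
   \esum_(v in [set v | ct_node T v /\ D v]) (ct_prob T v)%:E)%E.
Proof.
apply: esum_ge; exists [set` [seq v <- nodes n | D v]].
  split=> //= v; rewrite /= mem_filter => /andP[Dv /mem_nodes[Nv _]] //.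
by rewrite -fsbig_seq ?filter_uniq ?nodes_uniq // sumEFin big_filter.
Qed.

End Levels.

Lemma nodes_kids (Sg : signature) (T T' : ctree (Sg := Sg)) n :
  ct_kids T' = ct_kids T -> nodes T n = nodes T' n.
Proof.
move=> E; have El m : level T m = level T' m by elim: m => //= m ->; rewrite E.
by elim: n => //= n ->; rewrite El.
Qed.

(** * The potential and its expected decrease *)

Section Potential.
Context {Sg : signature}.
Local Notation term := (term Sg).
Local Notation adp := (adp Sg).
Local Notation dpair := (dpair (Sg := Sg)).
Variables (P : set adp) (L : seq dpair) (B : nat).
Hypothesis Pvalid : forall alpha, P alpha -> valid_adp (defined P) alpha.
Hypothesis HL : forall x, dpP P x -> List.In x L.
Hypothesis HB : forall alpha x r, P alpha -> List.In (x, r) (rhs alpha) ->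
  (size (annpos r) <= B)%N.

Lemma chain_prob_ge0 t0 T v : is_chain_tree P t0 T -> ct_node T v -> 0 <= ct_prob T v.
Proof.
move=> HT; have [_ p0 _ HN _] := HT; elim/last_ind: v => [_|v i IH]; first by rewrite p0.
rewrite HN => -[Nv lti]; have Kv : (0 < ct_kids T v)%N by case: (ct_kids T v) lti.
have [_ [[Pa _] _ Hsz _ /(_ i lti)[_ _ ->]]] := chain_step (valid_rhs_vars Pvalid) HT Nv Kv.
apply: mulr_ge0; first exact: IH.
have [_ _ _ H _] := Pvalid Pa; set pr := nth _ _ _.
have /H[_ _ /ltW] // : List.In (pr.1, pr.2) (rhs (ct_adp T v)).
by rewrite -surjective_pairing; apply: nth_In; rewrite -Hsz.
Qed.

(* A pair that reaches a cycle gets weight 0: steps with such a history are counted in the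
   restricted problems. The empty history dominates every nonempty one. *)
Definition weight (h : seq dpair) : nat :=
  if h is d :: _ then
    if `[< reaches_cycle P d >] then 0%N else (B.+1 ^ rank P L d)%N
  else (B.+1 ^ (size L).+1)%N.

Definition live (h : seq dpair) : Prop := if h is d :: _ then reaches_cycle P d else False.

Variables (t0 : term) (T : ctree (Sg := Sg)).
Hypothesis HT : is_chain_tree P t0 T.
Hypothesis wf0 : wf_term t0.
Hypothesis ann0 : forall p, ann t0 p -> p = [::].

Definition potential v : nat := \sum_(p <- annpos (ct_term T v)) weight (hist T v p).

Definition counted v : bool := (0 < ct_kids T v)%N && sharp_kind (ct_kind T v).
Definition counted_live v : bool := counted v && `[< live (hist T v (ct_pos T v)) >].
Definition counted_dead v : bool := counted v && ~~ `[< live (hist T v (ct_pos T v)) >].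

Lemma potential_root : (potential [::] <= B.+1 ^ (size L).+1)%N.
Proof.
have [_ _ E0 _ _] := HT; rewrite /potential E0.
apply: (@leq_trans (\sum_(p <- [:: [::]]) weight (hist T [::] p))).
  apply: leq_sum_subset; first exact: annpos_uniq.
  by move=> p; rewrite mem_annpos => /ann0 ->.
by rewrite big_seq1.
Qed.

Lemma weight_cons d h : (weight (d :: h) <= B.+1 ^ size L)%N.
Proof. by rewrite /=; case: ifP => // _; rewrite leq_pexp2l ?rank_size. Qed.

(** An amortised count valid for each child, not only on average. Rewriting an annotated redex
    trades its weight for at most [B] new annotations. Outside the reach of cycles they are lighter
    by a factor of at least [B+1], which leaves room to pay for the step; a live step is charged a
    fixed amount on the right. *)
Lemma potential_step v i : ct_node T v -> (0 < ct_kids T v)%N -> (i < ct_kids T v)%N ->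
  (counted_dead v + potential (rcons v i) <=
   potential v + counted_live v * B.+1 ^ (size L).+1)%N.
Proof.
move=> Nv Kv lti.
have Nvi : ct_node T (rcons v i) by have [_ _ _ -> _] := HT.
have [_ Hlin] := hist_lineage Pvalid HT wf0 Nvi.
have [sg [[Pa _] _ Hsz Hkd /(_ i lti)[_ Eann _]]] :=
  chain_step (valid_rhs_vars Pvalid) HT Nv Kv.
rewrite /counted_live /counted_dead /counted Kv Hkd /=.
move: Pa Hsz Eann Hlin; rewrite /potential.
have Ehist p : hist T (rcons v i) p = _ := hist_rcons T v i p.
move: Ehist; set alpha := ct_adp T v; set q := ct_pos T v; set s := ct_term T v.
set r := (nth _ _ _).2; move=> Ehist Pa Hsz Eann Hlin.
have HBr : (size (annpos r) <= B)%N.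
  apply: (HB (x := (nth (0, Var 0) (rhs alpha) i).1) Pa).
  by rewrite -surjective_pairing; apply: nth_In; rewrite -Hsz.
pose new := if ann s q then [seq q ++ p | p <- annpos r] else [::].
(* Only an inequality: a step with flag false also erases annotations above the redex. *)
have Hsplit : (\sum_(p <- annpos (ct_term T (rcons v i))) weight (hist T (rcons v i) p) <=
    \sum_(p <- annpos s | ~~ prefix q p) weight (hist T v p) +
    \sum_(p <- new) weight (hist T (rcons v i) p))%N.
  apply: (@leq_trans (\sum_(p <- [seq p <- annpos s | ~~ prefix q p] ++ new)
                        weight (hist T (rcons v i) p))).
    apply: leq_sum_subset; first exact: annpos_uniq.
    move=> p; rewrite mem_annpos Eann mem_cat mem_filter mem_annpos.
    case: ifP => [/prefixP[p' ->]|_ /andP[-> _]] //=.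
    by rewrite drop_size_cat // /new => /andP[-> rp']; rewrite map_f // mem_annpos.
  rewrite big_cat big_filter /= leq_add2r; apply: leq_sum => p /negbTE nqp.
  by rewrite Ehist nqp.
have Hold : (\sum_(p <- annpos s | ~~ prefix q p) weight (hist T v p) +
    ann s q * weight (hist T v q) <= \sum_(p <- annpos s) weight (hist T v p))%N.
  rewrite [leqRHS](bigID (prefix q)) /= addnC leq_add2r.
  case Es: (ann s q); last by rewrite mul0n.
  by rewrite (big_rem q) ?mem_annpos // prefix_refl mul1n leq_addr.
have Hnew M : (forall p, ann r p -> ann s q -> (weight (new_dp alpha r p :: hist T v q) <= M)%N) ->
    (\sum_(p <- new) weight (hist T (rcons v i) p) <= ann s q * (B * M))%N.
  move=> H; rewrite /new; case Es: (ann s q); last by rewrite big_nil.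
  rewrite big_map mul1n (@leq_trans (\sum_(p <- annpos r) M)) //.
    rewrite big_seq [leqRHS]big_seq; apply: leq_sum => p; rewrite mem_annpos => rp.
    by rewrite Ehist prefix_prefix drop_size_cat //; exact: H.
  by rewrite big_const_seq count_predT iter_addn_0 mulnC leq_mul2r HBr orbT.
case Es: (ann s q) Hold Hnew => Hold Hnew /=; last first.
  rewrite !mul0n !addn0 add0n in Hold *; apply: leq_trans Hsplit _.
  by rewrite -[leqRHS]addn0 leq_add //; exact: Hnew 0%N _.
rewrite mul1n in Hold.
suff [M HM Hw] : exists2 M,
    (forall p, ann r p -> (weight (new_dp alpha r p :: hist T v q) <= M)%N) &
    (~~ `[< live (hist T v q) >] + B * M <=
     weight (hist T v q) + `[< live (hist T v q) >] * B.+1 ^ (size L).+1)%N.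
  have {}Hnew := Hnew M (fun p rp _ => HM p rp); rewrite mul1n in Hnew.
  apply: leq_trans (leq_add (leqnn _) Hsplit) _.
  rewrite addnCA (leq_trans (leq_add (leqnn _) (leq_add (leqnn _) Hnew))) //.
  by rewrite (leq_trans (leq_add (leqnn _) Hw)) // addnA leq_add2r.
(* The origin of the base [B+1]: one step and [B] annotations of one power cost at most one
   annotation of the next power. *)
have Hpow k : (1 + B * B.+1 ^ k <= B.+1 ^ k.+1)%N.
  by rewrite expnS mulSn leq_add2r expn_gt0.
have [_ /(_ _ Es)[w [_ [Hpath _]]]] := hist_lineage Pvalid HT wf0 Nv.
have Hedge p : ann r p -> dg_path P (new_dp alpha r p :: hist T v q).
  move=> rp; have [|w' [_ []]] := Hlin (q ++ p).
    by rewrite Eann prefix_prefix drop_size_cat ?Es.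
  by rewrite Ehist prefix_prefix drop_size_cat.
case Eh : (hist T v q) Hpath Hedge => [|d h] Hpath Hedge.
(* Empty history: the redex weighs one power more than the bound on nonempty histories. *)
- exists (B.+1 ^ size L)%N; first by move=> p _; exact: weight_cons.
  by rewrite /live asboolF //= mul0n addn0; exact: Hpow.
have [cd|ncd] := pselect (reaches_cycle P d).
(* The redex weighs 0, so the new annotations are paid by the charge for live steps. *)
- exists (B.+1 ^ size L)%N; first by move=> p _; exact: weight_cons.
  by rewrite /live /weight asboolT //= add0n mul1n add0n expnS leq_mul2r leqnSn orbT.
- have Pd : dpP P d by case: Hpath.
  have rk0 : (0 < rank P L d)%N by apply: rank_gt0; exact: HL.
  (* New pairs are successors of [d]: they either have smaller rank or weigh 0. *)
  exists (B.+1 ^ (rank P L d).-1)%N.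
    move=> p /Hedge[_ de _]; rewrite /weight; case: asboolP => // _.
    by apply: leq_pexp2l => //; rewrite -ltnS prednK //; exact: rank_edge de ncd.
  rewrite /live /weight asboolF //= mul0n addn0.
  by rewrite -{2}(prednK rk0); exact: Hpow.
Qed.

(** Averages [potential_step] over the children, whose relative probabilities sum to 1. At a leaf
    the potential is simply given up. *)
Lemma node_step v : ct_node T v ->
  \sum_(i <- iota 0 (ct_kids T v)) ct_prob T (rcons v i) * (potential (rcons v i))%:R +
    (if counted_dead v then ct_prob T v else 0) <=
  ct_prob T v * (potential v)%:R +
    (B.+1 ^ (size L).+1)%:R * (if counted_live v then ct_prob T v else 0).
Proof.
move=> Nv; have pv := chain_prob_ge0 HT Nv.
have [K0|Kv] := posnP (ct_kids T v).
  by rewrite /counted_dead /counted_live /counted K0 /= big_nil addr0 mulr0 addr0 mulr_ge0.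
have [sg [[Pa _] _ Hsz _ Hch]] := chain_step (valid_rhs_vars Pvalid) HT Nv Kv.
have [_ _ _ Hrhs Hsum] := Pvalid Pa.
pose x i := (nth (0, Var 0) (rhs (ct_adp T v)) i).1.
have sumx : \sum_(i <- iota 0 (ct_kids T v)) x i = 1.
  by rewrite -Hsum (big_nth (0, Var 0)) /index_iota subn0 Hsz.
set C := (B.+1 ^ (size L).+1)%N.
have HE : (if counted_dead v then ct_prob T v else 0) = ct_prob T v * (counted_dead v)%:R.
  by case: ifP; rewrite ?mulr1 ?mulr0.
have HE' : (if counted_live v then ct_prob T v else 0) = ct_prob T v * (counted_live v)%:R.
  by case: ifP; rewrite ?mulr1 ?mulr0.
rewrite HE HE' mulrCA -mulrDr.
have -> : ct_prob T v * (counted_dead v)%:R =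
    \sum_(i <- iota 0 (ct_kids T v)) ct_prob T v * x i * (counted_dead v)%:R.
  by rewrite -mulr_suml -mulr_sumr sumx mulr1.
have -> : ct_prob T v * ((potential v)%:R + C%:R * (counted_live v)%:R) =
    \sum_(i <- iota 0 (ct_kids T v))
      ct_prob T v * x i * ((potential v)%:R + C%:R * (counted_live v)%:R).
  by rewrite -mulr_suml -mulr_sumr sumx mulr1.
rewrite -big_split /= big_seq [leRHS]big_seq; apply: ler_sum => i.
rewrite mem_iota add0n => /= lti; have [_ _ ->] := Hch i lti.
rewrite -/(x i) -mulrDr; apply: ler_wpM2l.
  apply: mulr_ge0 => //; have /Hrhs[_ _ /ltW] // :
    List.In (x i, (nth (0, Var 0) (rhs (ct_adp T v)) i).2) (rhs (ct_adp T v)).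
  by rewrite -surjective_pairing; apply: nth_In; rewrite -Hsz.
rewrite -natrM -!natrD ler_nat addnC mulnC; exact: potential_step.
Qed.

(** Summing [node_step] over the levels telescopes; what remains is the expected potential at depth
    [n]. *)
Lemma counted_dead_le n :
  \sum_(v <- nodes T n | counted_dead v) ct_prob T v +
    \sum_(v <- level T n) ct_prob T v * (potential v)%:R <=
  (B.+1 ^ (size L).+1)%:R +
    (B.+1 ^ (size L).+1)%:R * \sum_(v <- nodes T n | counted_live v) ct_prob T v.
Proof.
elim: n => [|n IH] /=.
  rewrite !big_nil big_seq1 add0r mulr0 addr0; have [_ -> _ _ _] := HT.
  by rewrite mul1r ler_nat potential_root.
rewrite big_allpairs_dep /= !big_cat /= mulrDr addrA.
apply: le_trans (lerD IH (lexx _)); rewrite -!addrA lerD2l.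
rewrite [X in X + _ <= _]big_mkcond [X in _ <= _ + _ * X]big_mkcond /= mulr_sumr.
rewrite -!big_split /= big_seq [leRHS]big_seq; apply: ler_sum => v.
by move=> /(mem_level HT)[Nv _]; rewrite addrC; exact: node_step.
Qed.

Lemma counted_le n :
  \sum_(v <- nodes T n | counted v) ct_prob T v <=
  (B.+1 ^ (size L).+1)%:R +
    (B.+1 ^ (size L).+1).+1%:R * \sum_(v <- nodes T n | counted_live v) ct_prob T v.
Proof.
rewrite (bigID (fun v => `[< live (hist T v (ct_pos T v)) >])) /=.
(* The live steps themselves are counted too, hence the successor in the second constant. *)
rewrite -natr1 mulrDl mul1r addrA addrC lerD2r.
apply: le_trans (counted_dead_le n); rewrite lerDl big_seq; apply: sumr_ge0 => v.
by move=> /(mem_level HT)[/(chain_prob_ge0 HT) ? _]; rewrite mulr_ge0.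
Qed.

End Potential.

(** * Comparing the annotated steps of a tree with those of its restrictions *)

Section EdlBound.
Context {Sg : signature}.
Local Notation term := (term Sg).
Local Notation adp := (adp Sg).
Local Notation dpair := (dpair (Sg := Sg)).
Implicit Types (P S : set adp) (t : term) (T : ctree (Sg := Sg)).

Lemma edlE S T : edl S T = \esum_(v in [set v | ct_node T v /\
  (counted T v && `[< S (ct_adp T v) >])]) (ct_prob T v)%:E.
Proof.
rewrite /edl; congr esum; apply/seteqP; split=> v /=.
- by move=> [Nv Kv Sv /sharp_kindP k]; rewrite /counted Kv k; split=> //; apply/asboolP.
- move=> [Nv /andP[/andP[Kv k] /asboolP Sv]]; split=> //; exact/sharp_kindP.
Qed.

Lemma subset_esum (I : choiceType) (A A' : set I) (F : I -> \bar R) : A `<=` A' ->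
  (forall i, A' i -> (0 <= F i)%E) -> (\esum_(i in A) F i <= \esum_(i in A') F i)%E.
Proof.
move=> AA' F0; rewrite -(setIidr AA') esum_mkcondr; apply: le_esum => i A'i.
by case: ifP => // _; exact: F0.
Qed.

Lemma edl_le S S' T T' : ct_node T' = ct_node T -> ct_prob T' = ct_prob T ->
  (forall v, ct_node T v -> 0 <= ct_prob T v) ->
  (forall v, ct_node T v -> counted T v -> S (ct_adp T v) ->
     counted T' v /\ S' (ct_adp T' v)) -> (edl S T <= edl S' T')%E.
Proof.
move=> En Ep p0 H; rewrite !edlE En Ep; apply: subset_esum => v [Nv].
- by move=> /andP[cv /asboolP Sv]; split=> //; have [-> ?] := H v Nv cv Sv; apply/asboolP.
- by move=> _; rewrite lee_fin p0.
Qed.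

Lemma edl_split P S T : (forall v, ct_node T v -> 0 <= ct_prob T v) ->
  (edl P T <= edl S T + edl (P `\` S) T)%E.
Proof.
move=> p0; rewrite !edlE.
rewrite (esumID [set v | S (ct_adp T v)]); last by move=> v [Nv _]; rewrite lee_fin p0.
apply: leeD; apply: subset_esum => v /=.
- by move=> [[Nv /andP[cv _]] Sv]; rewrite cv; split=> //; apply/asboolP.
- by move=> [Nv _]; rewrite lee_fin p0.
- move=> [[Nv /andP[cv /asboolP Pv]] Sv]; rewrite cv; split=> //; exact/asboolP.
- by move=> [Nv _]; rewrite lee_fin p0.
Qed.

(** A superset suffices, so the pair with bottom is listed for every ADP. *)
Lemma dp_list P : finite_set P -> exists L : seq dpair, forall x, dpP P x -> List.In x L.
Proof.
move=> /finite_set_list[Ps HPs].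
exists (flatten [seq (sharp_root (lhs alpha), None) ::
  flatten [seq [seq new_dp alpha pr.2 p | p <- annpos pr.2] | pr <- rhs alpha] | alpha <- Ps]).
move=> x [alpha [/HPs Pa Hx]]; apply/In_flatten; eexists; first by apply/In_map; exists alpha.
case: Hx => [[z [r [t [p [Hr Hs ->]]]]]|[_ ->]]; last by left.
right; apply/In_flatten; eexists; first by apply/In_map; exists (z, r).
have rp := ann_sub_ann Hs; case: Hs => f [ts [E ->]].
apply/In_map; exists p; first by apply: In_mem; rewrite mem_annpos.
by rewrite /new_dp E.
Qed.

Lemma annpos_bound P : finite_set P -> exists B, forall alpha x r,
  P alpha -> List.In (x, r) (rhs alpha) -> (size (annpos r) <= B)%N.
Proof.
move=> /finite_set_list[Ps HPs].
exists (\max_(alpha <- Ps) \max_(pr <- rhs alpha) size (annpos pr.2)).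
move=> alpha x r /HPs Pa Hr.
apply: leq_trans (leq_bigmax_In (fun alpha => \max_(pr <- rhs alpha) size (annpos pr.2)) Pa).
exact: (leq_bigmax_In (fun pr => size (annpos pr.2)) Hr).
Qed.

Lemma SCC_prefix_list P : finite_set P -> exists Js : seq (set dpair),
  forall J, SCC_prefix P J <-> List.In J Js.
Proof.
move=> /dp_list[L HL]; have [ss Hss] := finite_powerlist L.
exists (List.filter (fun J => `[< SCC_prefix P J >]) ss) => J.
rewrite List.filter_In; split=> [HJ|[_ /asboolP //]]; split; last exact/asboolP.
apply: Hss => x Jx; apply: HL; case: HJ => G [_ _ [JP _ _] _]; exact: JP.
Qed.

Lemma ler_sum_In (I : Type) (s : seq I) (x : I) (F : I -> R) :
  List.In x s -> (forall y, 0 <= F y) -> F x <= \sum_(y <- s) F y.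
Proof.
move=> + F0; elim: s => //= y s IH [->|/IH H]; rewrite big_cons.
- by rewrite lerDl sumr_ge0.
- by rewrite (le_trans H) // lerDr.
Qed.

Lemma edl_bound P Js : finite_set P ->
  (forall alpha, P alpha -> valid_adp (defined P) alpha) ->
  (forall J, SCC_prefix P J <-> List.In J Js) ->
  exists C : nat, forall t T, basic P t -> is_chain_tree P (sharp_root t) T ->
  (edl P T <= C%:R%:E + C%:R%:E *
     \sum_(J <- Js) edh (restrict_set P J P) (restrict_set P J P) t)%E.
Proof.
move=> finP Pv HJs; have [L HL] := dp_list finP; have [B HB] := annpos_bound finP.
exists (B.+1 ^ (size L).+1).+1 => t T bt HT.
have wf0 : wf_term (sharp_root t) by case: bt => f [ts [-> _]].
have p0 v : ct_node T v -> 0 <= ct_prob T v := chain_prob_ge0 Pv HT.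
have /choice[TJ HTJ] := fun J => restricted_tree Pv J HT.
rewrite edlE; apply: (@le_trans _ _ (\esum_(v in [set v | ct_node T v /\ counted T v])
    (ct_prob T v)%:E)%E).
  by apply: subset_esum => v; [move=> [Nv /andP[]]|move=> [Nv _]; rewrite lee_fin p0].
apply: (esum_nodes_le HT p0) => n.
have := counted_le Pv HL HB HT wf0 (fun p => basic_ann bt) n; set C := (_ ^ _)%N => Hn.
apply: (@le_trans _ _ (C.+1%:R +
    C.+1%:R * \sum_(v <- nodes T n | counted_live P T v) ct_prob T v)%:E).
  by rewrite lee_fin (le_trans Hn) // lerD2r ler_nat.
rewrite EFinD leeD2lE // EFinM; apply: lee_wpmul2l; first by rewrite lee_fin.
(* The restricted trees share nodes and probabilities with [T], and each live step is counted in at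
   least one of them. *)
apply: (@le_trans _ _ (\sum_(J <- Js) \sum_(v <- nodes T n | counted (TJ J) v) ct_prob T v)%:E).
  rewrite lee_fin big_mkcond /=.
  under [leRHS]eq_bigr do rewrite big_mkcond /=.
  rewrite exchange_big /= big_seq [leRHS]big_seq; apply: ler_sum => v.
  move=> /(mem_nodes HT)[Nv _]; have pv := p0 v Nv.
  have F0 J : 0 <= (if counted (TJ J) v then ct_prob T v else 0) by case: ifP.
  case: ifP => [/andP[/andP[Kv kv] /asboolP lv]|_]; last exact: sumr_ge0.
  have [_ [_ _ _ Hk _]] := chain_step (valid_rhs_vars Pv) HT Nv Kv.
  have [_ Hlin] := hist_lineage Pv HT wf0 Nv.
  have [|w [_ [Hpath _]]] := Hlin (ct_pos T v); first by rewrite -Hk.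
  case Eh: (hist T v (ct_pos T v)) lv Hpath => [//|d h] cd Hpath.
  have [J HJ hJ] := path_in_prefix HL Hpath cd.
  have [_ [_ _ EK _ /(_ v Nv Kv kv)]] := HTJ J; rewrite Eh => /(_ hJ) kJ.
  apply: le_trans (ler_sum_In ((HJs J).1 HJ) F0).
  by rewrite /counted EK Kv kJ.
rewrite -sumEFin; apply: lee_sum => J _.
have [HJ [En Ep Ek Ea _]] := HTJ J.
have -> : nodes T n = nodes (TJ J) n by exact: nodes_kids.
rewrite -Ep; apply: le_trans (nodes_le_esum HJ _ _) _.
apply: (@le_trans _ _ (edl (restrict_set P J P) (TJ J))).
  rewrite edlE; apply: subset_esum => v [Nv].
    move=> cv; split=> //; rewrite cv; apply/asboolP.
    by case/andP: cv => Kv _; case: HJ => _ _ _ _ /(_ v Nv Kv)[sg []].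
  by move=> _; rewrite lee_fin Ep p0 // -En.
by apply: ereal_sup_ubound; exists (TJ J).
Qed.

End EdlBound.

(** * Complexities *)

Section DerivationalComplexity.
Context {Sg : signature}.
Local Notation adp := (adp Sg).
Local Notation dpair := (dpair (Sg := Sg)).
Implicit Types (P S : set adp) (J : set dpair).

Lemma dh_fun_mono P S m n : (m <= n)%N -> (dh_fun P S m <= dh_fun P S n)%E.
Proof.
move=> mn; apply: le_ereal_sup => _ [t [bt st] <-]; exists t => //; split=> //.
exact: leq_trans st mn.
Qed.

Lemma edh_le_dh P S t n : basic P t -> (tsize t <= n)%N -> (edh P S t <= dh_fun P S n)%E.
Proof. by move=> bt st; apply: ereal_sup_ubound; exists t. Qed.

Lemma dh_fun_le P S (M : \bar R) n :
  (forall t T, basic P t -> (tsize t <= n)%N -> is_chain_tree P (sharp_root t) T ->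
     (edl S T <= M)%E) ->
  (dh_fun P S n <= M)%E.
Proof.
move=> H; apply: ge_ereal_sup => _ [t [bt st] <-].
by apply: ge_ereal_sup => _ [T HT <-]; exact: H bt st HT.
Qed.

Lemma edl_le_dh P S t T n : basic P t -> (tsize t <= n)%N ->
  is_chain_tree P (sharp_root t) T -> (edl S T <= dh_fun P S n)%E.
Proof.
move=> bt st HT; apply: le_trans (edh_le_dh S bt st).
by apply: ereal_sup_ubound; exists T.
Qed.

Variable P : set adp.
Hypothesis Pvalid : forall alpha, P alpha -> valid_adp (defined P) alpha.

Lemma dh_fun_sub S S' n : S `<=` S' -> (dh_fun P S n <= dh_fun P S' n)%E.
Proof.
move=> SS'; apply: dh_fun_le => t T bt st HT; apply: le_trans (edl_le_dh S' bt st HT).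
apply: edl_le => // v; first exact: chain_prob_ge0 HT.
by move=> _ cv /SS'.
Qed.

Lemma restricted_prob_ge0 J t0 T : is_chain_tree (restrict_set P J P) t0 T ->
  forall v, ct_node T v -> 0 <= ct_prob T v.
Proof.
move=> /(lifted_tree Pvalid)[T' [HT' [<- <- _ _]]] v; exact: chain_prob_ge0 HT'.
Qed.

Lemma dh_restrict_split S J n :
  (dh_fun (restrict_set P J P) (restrict_set P J P) n <=
   dh_fun (restrict_set P J P) (restrict_set P J S) n +
   dh_fun (restrict_set P J P) (restrict_set P J P `\` restrict_set P J S) n)%E.
Proof.
apply: dh_fun_le => t T bt st HT.
apply: le_trans (edl_split _ (restrict_set P J S) (restricted_prob_ge0 HT)) _.
by apply: leeD; exact: edl_le_dh bt st HT.
Qed.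

(** If the restriction of an ADP is not in [S|J], then the ADP itself is not in [S]; so any choice
    of preimages in the lifted tree works. *)
Lemma dh_restrict_le S J n :
  (dh_fun (restrict_set P J P) (restrict_set P J P `\` restrict_set P J S) n <=
   dh_fun P (P `\` S) n)%E.
Proof.
apply: dh_fun_le => t T /basic_restrict bt st HT.
have [T' [HT' [En Ep EK Ha]]] := lifted_tree Pvalid HT.
apply: le_trans (edl_le_dh _ bt st HT'); apply: edl_le => // v.
  exact: restricted_prob_ge0 HT _.
move=> Nv /andP[Kv kv] [_ nS]; have [Pa Er Hk] := Ha v Nv Kv.
rewrite /counted EK Kv Hk //; split=> //; split=> // Sa; apply: nS.
by rewrite Er; exists (ct_adp T' v).
Qed.

Lemma dh_bound S Js : finite_set P -> (forall J, SCC_prefix P J <-> List.In J Js) ->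
  exists C : nat, forall n,
  (dh_fun P P n <= C%:R%:E + C%:R%:E * \sum_(J <- Js)
     (dh_fun (restrict_set P J P) (restrict_set P J S) n + dh_fun P (P `\` S) n))%E.
Proof.
move=> finP HJs; have [C HC] := edl_bound finP Pvalid HJs; exists C => n.
apply: dh_fun_le => t T bt st HT; apply: le_trans (HC t T bt HT) _.
apply: leeD2l; apply: lee_wpmul2l; first by rewrite lee_fin.
apply: lee_sum => J _; have bt' := (basic_restrict P J t).2 bt.
apply: le_trans (edh_le_dh _ bt' st) _.
apply: le_trans (dh_restrict_split S J n) _.
by apply: leeD2l; exact: dh_restrict_le.
Qed.

End DerivationalComplexity.

(** * The order on complexities and the growth classes of functions *)

Lemma cle_refl x : cle x x.
Proof. by case: x => /=. Qed.

Lemma cle_trans y x z : cle x y -> cle y z -> cle x z.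
Proof. by case: x y z => [a|||| ] [b|||| ] [c|||| ] //=; exact: leq_trans. Qed.

Lemma cle_total x y : cle x y || cle y x.
Proof. by case: x y => [a|||| ] [b|||| ] //=; exact: leq_total. Qed.

Lemma cle_maxl x y : cle x (cmax x y).
Proof. by rewrite /cmax; case: ifP => //; rewrite cle_refl. Qed.

Lemma cle_maxr x y : cle y (cmax x y).
Proof. by rewrite /cmax; have := cle_total x y; case: ifP => //; rewrite cle_refl. Qed.

(** [cmax_set] is only meaningful once a maximum is known to exist; it is found by running through
    the list. *)
Lemma cmax_set_ub (Y : set cmplx) (s : seq cmplx) y :
  (forall z, Y z -> List.In z s) -> Y y -> cle y (cmax_set Y).
Proof.
move=> Ys Yy; suff : exists m, Y m /\ forall z, Y z -> cle z m.
  by move=> /(xgetPex (Pol 0))[_]; apply.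
suff [m [Ym Hm]] : exists m, Y m /\ forall z, Y z -> List.In z s -> cle z m.
  by exists m; split=> // z Yz; apply: Hm => //; exact: Ys.
elim: s {Ys} => [|x s [m [Ym Hm]]]; first by exists y.
have [Yx|nYx] := pselect (Y x); last first.
  by exists m; split=> // z Yz [E|]; [rewrite E in nYx|exact: Hm].
exists (cmax m x); split; first by rewrite /cmax; case: ifP.
move=> z Yz [<-|zs]; first exact: cle_maxr.
exact: cle_trans (Hm _ Yz zs) (cle_maxl _ _).
Qed.

(** Drops the minimality conditions of [classify]. For monotone [f] it amounts to [iota_c f] being
    at most [c], and it is closed under sums and constant factors. *)
Definition bounded_by (c : cmplx) (f : nat -> \bar R) : Prop :=
  match c with
  | Pol a => bigO f (fun n => (n%:R : R) ^+ a)
  | CExp => exists cs, bigO f (fun n => (2 : R) ^+ peval cs n)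
  | CExp2 => exists cs, bigO f (fun n => (2 : R) ^+ (2 ^ peval cs n))
  | CFin => forall n, f n != +oo%E
  | COmega => True
  end.

Lemma iota_classify f : classify f (iota_c f).
Proof.
apply: xgetPex.
have [H|nPol] := pselect (exists a, `[< bigO f (fun n => (n%:R : R) ^+ a) >]).
  case: (ex_minnP H) => a /asboolP Ha Hmin; exists (Pol a); split=> // b ba.
  by move/asboolP/Hmin; rewrite leqNgt ba.
have {}nPol a : ~ bigO f (fun n => (n%:R : R) ^+ a).
  by move=> Ha; apply: nPol; exists a; apply/asboolP.
have [?|nE] := pselect (exists cs, bigO f (fun n => (2 : R) ^+ peval cs n)).
  by exists CExp; split.
have [?|nE2] := pselect (exists cs, bigO f (fun n => (2 : R) ^+ (2 ^ peval cs n))).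
  by exists CExp2; split.
have [?|] := pselect (forall n, f n != +oo%E); first by exists CFin.
by move=> /existsNP[n /negP/negPn/eqP Hn]; exists COmega; do 3!split=> //; exists n.
Qed.

Lemma iota_le c f : bounded_by c f -> cle (iota_c f) c.
Proof.
have := iota_classify f; case: (iota_c f) => [b|||| ] /=; case: c => [a|||| ] //=.
- by move=> [_ Hmin] Ha; rewrite leqNgt; apply/negP => /Hmin.
- by move=> [+ _] Ha => /(_ a).
- by move=> [+ _] Ha => /(_ a).
- by move=> [_ []].
- by move=> [+ _] Ha => /(_ a).
- by move=> [_ []].
- by move=> [_ [_ []]].
- by move=> [+ _] Ha => /(_ a).
- by move=> [_ []].
- by move=> [_ [_ []]].
- by move=> [_ [_ [_ [n /eqP Hn]]]] /(_ n); rewrite Hn.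
Qed.

Lemma bigO_weaken f g h : bigO f g ->
  (forall n, (0 < n)%N -> 0 <= g n) -> (forall n, (0 < n)%N -> g n <= h n) -> bigO f h.
Proof.
(* The absolute value covers a negative [c]; the successor excludes the argument 0, where powers of
   [n] need not increase with the exponent. *)
move=> [c [n0 H]] g0 gh; exists `|c|, n0.+1 => n Hn.
have n_gt0 : (0 < n)%N by exact: leq_trans Hn.
apply: le_trans (H n (ltnW Hn)) _; rewrite lee_fin.
apply: (@le_trans _ _ (`|c| * g n)); first by rewrite ler_wpM2r ?g0 ?ler_norm.
by rewrite ler_wpM2l ?gh.
Qed.

Lemma bigO_add f f' g : bigO f g -> bigO f' g -> bigO (fun n => f n + f' n)%E g.
Proof.
move=> [c [n0 H]] [c' [n0' H']]; exists (c + c'), (maxn n0 n0') => n.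
rewrite geq_max => /andP[/H Hn /H' Hn']; rewrite mulrDl EFinD; exact: leeD.
Qed.

Lemma bigO_scale f g (C : nat) : bigO f g -> bigO (fun n => C%:R%:E * f n)%E g.
Proof.
move=> [c [n0 H]]; exists (C%:R * c), n0 => n /H Hn.
by rewrite -mulrA EFinM lee_wpmul2l // lee_fin.
Qed.

Lemma bigO_le f f' g : (forall n, f n <= f' n)%E -> bigO f' g -> bigO f g.
Proof. by move=> H [c [n0 Hc]]; exists c, n0 => n /Hc; exact: le_trans. Qed.

Fixpoint padd (cs ds : seq nat) : seq nat :=
  match cs, ds with
  | [::], _ => ds
  | _, [::] => cs
  | c :: cs', d :: ds' => (c + d)%N :: padd cs' ds'
  end.

Lemma peval_cons c cs n : peval (c :: cs) n = (c + n * peval cs n)%N.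
Proof.
rewrite /peval big_ord_recl expn0 muln1 big_distrr; congr addn.
by apply: eq_bigr => i _; rewrite /= /bump expnS mulnCA.
Qed.

Lemma peval_padd cs ds n : peval (padd cs ds) n = (peval cs n + peval ds n)%N.
Proof.
have peval0 : peval [::] n = 0%N by rewrite /peval big_ord0.
elim: cs ds => [|c cs IH] [|d ds]; rewrite /= ?peval0 ?addn0 //.
by rewrite !peval_cons IH mulnDr addnACA.
Qed.

Lemma ler_exp2 m n : (m <= n)%N -> (2 : R) ^+ m <= 2 ^+ n.
Proof. by move=> mn; rewrite ler_weXn2l // ler1n. Qed.

(** Monotonicity serves the step to [CFin]: a [bigO] bound holds only eventually, finiteness is
    demanded everywhere. *)
Lemma bounded_weaken c c' f : {homo f : m n / (m <= n)%N >-> (m <= n)%E} ->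
  cle c c' -> bounded_by c f -> bounded_by c' f.
Proof.
move=> fmono.
have PolE a : bounded_by (Pol a) f -> bounded_by CExp f.
  (* The exponent is the polynomial a n, since n^a is at most (2^n)^a. *)
  move=> H; exists [:: 0%N; a]; apply: bigO_weaken H _ _ => n _; first by rewrite exprn_ge0.
  rewrite !peval_cons {1}/peval big_ord0 muln0 addn0 add0n.
  rewrite -!natrX ler_nat expnM; case: a => // a.
  by rewrite leq_exp2r // ltnW // ltn_expl.
have ExpE : bounded_by CExp f -> bounded_by CExp2 f.
  move=> [cs H]; exists cs; apply: bigO_weaken H _ _ => n _; first by rewrite exprn_ge0.
  by apply: ler_exp2; apply/ltnW/ltn_expl.
(* An infinite value would persist at all larger arguments, where the bound is finite. *)
have FinE g : bigO f g -> bounded_by CFin f.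
  move=> [k [n0 H]] n; apply/eqP => Hn.
  have := le_trans (fmono _ _ (leq_maxl n n0)) (H _ (leq_maxr n n0)).
  by rewrite Hn leNgt ltey.
case: c c' => [a|||| ] [b|||| ] //= ab.
- move=> H; apply: bigO_weaken H _ _ => n n0; first by rewrite exprn_ge0.
  by rewrite ler_weXn2l // ler1n.
- exact: PolE.
- by move=> /PolE/ExpE.
- exact: FinE.
- by move=> [cs]; exact: FinE.
- by move=> [cs]; exact: FinE.
Qed.

Lemma bounded_iota c f : {homo f : m n / (m <= n)%N >-> (m <= n)%E} ->
  cle (iota_c f) c -> bounded_by c f.
Proof.
move=> fmono H; apply: (bounded_weaken fmono H); have := iota_classify f.
by case: (iota_c f) => [a|||| ] /=; [case|case|case=> _ []|case=> _ [_ []]|].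
Qed.

Lemma bounded_le c f f' : (forall n, f n <= f' n)%E -> bounded_by c f' -> bounded_by c f.
Proof.
move=> H; case: c => [a|||| ] //=.
- exact: bigO_le.
- by move=> [cs] /(bigO_le H); exists cs.
- by move=> [cs] /(bigO_le H); exists cs.
- by move=> Hf n; rewrite -ltey (le_lt_trans (H n)) // ltey.
Qed.

Lemma bounded_add c f f' : bounded_by c f -> bounded_by c f' ->
  bounded_by c (fun n => f n + f' n)%E.
Proof.
case: c => [a|||| ] //=.
- exact: bigO_add.
- move=> [cs H] [cs' H']; exists (padd cs cs'); apply: bigO_add.
  + apply: bigO_weaken H _ _ => n _; first by rewrite exprn_ge0.
    by apply: ler_exp2; rewrite peval_padd leq_addr.
  + apply: bigO_weaken H' _ _ => n _; first by rewrite exprn_ge0.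
    by apply: ler_exp2; rewrite peval_padd leq_addl.
- move=> [cs H] [cs' H']; exists (padd cs cs'); apply: bigO_add.
  + apply: bigO_weaken H _ _ => n _; first by rewrite exprn_ge0.
    by apply: ler_exp2; rewrite leq_exp2l // peval_padd leq_addr.
  + apply: bigO_weaken H' _ _ => n _; first by rewrite exprn_ge0.
    by apply: ler_exp2; rewrite leq_exp2l // peval_padd leq_addl.
- by move=> H H' n; rewrite -ltey lte_add_pinfty // ltey.
Qed.

Lemma bounded_scale c f (C : nat) : bounded_by c f -> bounded_by c (fun n => C%:R%:E * f n)%E.
Proof.
case: c => [a|||| ] //=.
- exact: bigO_scale.
- by move=> [cs] /(@bigO_scale _ _ C); exists cs.
- by move=> [cs] /(@bigO_scale _ _ C); exists cs.
(* The value -oo does occur: no basic term has size 0, so [dh_fun] at 0 is the supremum of the empty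
   set. *)
- move=> H n; have := H n; case: (f n) => [r _|//|_]; first by rewrite -EFinM.
  case: C => [|C]; first by rewrite mul0e.
  by rewrite gt0_muleNy // lte_fin ltr0n.
Qed.

Lemma bounded_const c (C : nat) : bounded_by c (fun=> C%:R%:E).
Proof.
apply: (@bounded_weaken (Pol 0)) => //; first by case: c.
by exists C%:R, 0%N => n _; rewrite expr0 mulr1.
Qed.

Lemma bounded_sum c (I : Type) (s : seq I) (F : I -> nat -> \bar R) :
  (forall i, List.In i s -> bounded_by c (F i)) ->
  bounded_by c (fun n => \sum_(i <- s) F i n)%E.
Proof.
elim: s => [|i s IH] H.
  by apply: bounded_le (bounded_const c 0) => n; rewrite big_nil.
apply: (@bounded_le _ _ (fun n => F i n + \sum_(i <- s) F i n)%E).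
  by move=> n; rewrite big_cons.
by apply: bounded_add; [apply: H; left|apply: IH => j Hj; apply: H; right].
Qed.

Theorem mainTheorem6 (Sg : signature) : sound (Proc_DG (Sg:=Sg)).
Proof.
move=> [P S] [/= finP SP Pv] T a u [_ wfT] Hu Eu.
have [_ +] := wfT a u Hu; rewrite Eu /=; set pm := path_max T a => HPS.
have Hmono P' S' : {homo dh_fun (Sg := Sg) P' S' : m n / (m <= n)%N >-> (m <= n)%E}.
  by move=> m n; exact: dh_fun_mono.
have HbPS c : cle pm c -> bounded_by c (dh_fun P (P `\` S)).
  by move=> Hc; apply: bounded_iota => //; exact: cle_trans HPS Hc.
split; last first.
  move=> _ [J _ <-] /=; apply: iota_le; apply: bounded_le (HbPS _ (cle_maxl _ _)).
  exact: dh_restrict_le.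
have [Js HJs] := SCC_prefix_list finP.
apply: iota_le; set c := cmax _ _.
have pmc : cle pm c by exact: cle_trans (cle_maxl _ _) (cle_maxl _ _).
(* Enlarging [S] to [P] is affordable, because [HbPS] bounds the part [P \ S] by the complexities on
   the path. *)
apply: bounded_le (fun n => dh_fun_sub Pv n SP) _.
have [C HC] := dh_bound Pv S finP HJs; apply: bounded_le HC _.
apply: bounded_add; first exact: bounded_const.
apply: bounded_scale; apply: bounded_sum => J /HJs HJ.
apply: bounded_add; last exact: HbPS.
apply: bounded_iota => //; apply: cle_trans (cle_maxr _ _).
apply: (@cmax_set_ub _ [seq iota_pb (restrict_set P J P, restrict_set P J S) | J <- Js]).
  by move=> _ [_ [K HK <-] <-]; apply/In_map; exists K => //; exact/HJs.
by eexists; first by exists J.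
Qed.
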